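(* Let $\mu$ be a real positive measure on $(0,1)$. Let $(a_n)_{n\ge 0}$ and $(b_n)_{n\ge 0}$ be sequences of nonnegative real numbers such that $$f(z)=\sum_{n=0}^{\infty}(-1)^n a_n z^{2n},\qquad g(z)=\sum_{n=0}^{\infty}(-1)^n b_n z^{2n}$$ are entire functions. Assume that the zeros of $f$ and of $g$ are real and simple, and that each of $f$ and $g$ has a countably infinite number of zeros. Let $\zeta_n$ denote the $n$th positive zero of $f$ and $\lambda_n$ the $n$th positive zero of $g$ ($n=1,2,\dots$). If the orders of $f$ and $g$ are both less than two, $$\frac{a_n}{b_n}\to 0\quad\text{as } n\to\infty,$$ and $\lambda_n\le\zeta_n$ for all $n\ge1$, then the sequence of functions $\{f(\lambda_n x)\}_{n\ge 1}$ is complete $L[\mu,(0,1)]$.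
   Context: The order of an entire function $f$ is $\varrho(f)=\limsup_{r\to\infty}\frac{\log\log M(r;f)}{\log r}$, where $M(r;f)=\max_{|z|=r}|f(z)|$. A sequence of functions $\{f_n\}_{n\ge1}$ on $(0,1)$ is said to be complete $L[\mu,(0,1)]$ (that is, complete in $L^1[\mu,(0,1)]$) if, whenever $y\in L^1[\mu,(0,1)]$ satisfies $\int_{(0,1)} y f_n\,d\mu=0$ for all $n=1,2,\dots$, one has $y=0$ $\mu$-almost everywhere. *)

(* Defs.v *)
From HB Require Import structures.
From mathcomp Require Import all_boot all_order all_algebra.
From mathcomp Require Import all_classical all_reals all_analysis.
From mathcomp Require Import complex.

Set Implicit Arguments.
Unset Strict Implicit.
Unset Printing Implicit Defensive.

Import Order.TTheory GRing.Theory Num.Theory.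
Import numFieldNormedType.Exports.

Local Open Scope classical_set_scope.
Local Open Scope ring_scope.
Local Open Scope complex_scope.

(* The library equips every abstract [numFieldType] with the topology of its
   norm, but not the concrete type [R[i]]; these instances do so. *)
HB.instance Definition _ (R : realType) :=
  PseudoPointedMetric.copy R[i] R[i]^o.
HB.instance Definition _ (R : realType) := GRing.ComAlgebra.copy R[i] R[i]^o.
HB.instance Definition _ (R : realType) := Vector.copy R[i] R[i]^o.
HB.instance Definition _ (R : realType) := NormedModule.copy R[i] R[i]^o.
HB.instance Definition _ (R : realType) := Num.ClosedField.on R[i].

(* Derivability over the field [R[i]] is complex differentiability. *)
Definition entire (R : realType) (f : R[i] -> R[i]) : Prop :=
  forall z : R[i], derivable f z 1.

Definition even_alternating_series (R : realType) (a : nat -> R)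
    (f : R[i] -> R[i]) : Prop :=
  forall z : R[i],
    series (fun n => (-1) ^+ n * (a n)%:C * z ^+ (2 * n)) @ \oo --> f z.

(* [`|w|] lives in [R[i]]; its real part is the modulus as an element of [R].
   For entire [f] and [0 <= r] the supremum is attained on the compact circle. *)
Definition max_modulus (R : realType) (f : R[i] -> R[i]) (r : R) : R :=
  sup [set complex.Re `|f z| | z in [set z : R[i] | `|z| = r%:C]].

(* [ln] is [0] on nonpositive reals; for nonconstant entire [f] this does not
   affect the upper limit, since [max_modulus f] tends to infinity. *)
Definition growth_order (R : realType) (f : R[i] -> R[i]) : \bar R :=
  limf_esup (fun r : R => (ln (ln (max_modulus f r)) / ln r)%:E) +oo%R.

Definition zero_set (R : realType) (f : R[i] -> R[i]) : set R[i] :=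
  [set z | f z = 0].

Definition real_simple_zeros (R : realType) (f : R[i] -> R[i]) : Prop :=
  forall z : R[i], zero_set f z -> complex.Im z = 0 /\ derive1 f z != 0.

(* [s n] is the (n+1)-st positive zero of [f]. *)
Definition positive_zeros (R : realType) (f : R[i] -> R[i])
    (s : nat -> R) : Prop :=
  {homo s : m n / (m < n)%N >-> m < n} /\
  range s = [set x : R | 0 < x /\ zero_set f x%:C].

Definition Cintegrable d (T : measurableType d) (R : realType)
    (mu : {measure set T -> \bar R}) (D : set T) (h : T -> R[i]) : Prop :=
  mu.-integrable D (fun x => (complex.Re (h x))%:E) /\
  mu.-integrable D (fun x => (complex.Im (h x))%:E).

Definition Cintegral d (T : measurableType d) (R : realType)
    (mu : {measure set T -> \bar R}) (D : set T) (h : T -> R[i]) : R[i] :=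
  Rintegral mu D (fun x => complex.Re (h x)) +i*
  Rintegral mu D (fun x => complex.Im (h x)).

(* Test functions [y] are complex valued.  For a real-valued family [F] this is
   the same as testing against real-valued [y] only.  The products [y * F n] are
   integrable when each [F n] is bounded and measurable on [D]; otherwise
   [Rintegral] may take a default value.  A measure on [D] is represented by a
   measure on the ambient [T], of which only the part on [D] is used. *)
Definition complete_L1 d (T : measurableType d) (R : realType)
    (mu : {measure set T -> \bar R}) (D : set T) (F : nat -> T -> R[i]) : Prop :=
  forall y : T -> R[i],
    Cintegrable mu D y ->
    (forall n, Cintegral mu D (fun x => y x * F n x) = 0) ->
    {ae mu, forall x, D x -> y x = 0}.

(* Main.v *)
(** In the variable [w = z ^ 2], [f] and [g] are power series [phi] and [gamma] of order less than
    one, so by Hadamard's theorem they are [phi 0 * \prod_k (1 - w / zeta_k ^ 2)] and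
    [gamma 0 * \prod_k (1 - w / lambda_k ^ 2)]. If [y] annihilates every [f (lambda_n x)] and
    [m_j] is its moment of order [2 j], then the coefficients [(-1) ^ j * a_j * m_j] define a
    series [eta], [eta w = \int y x * phi (w * x ^ 2)], which vanishes at every [lambda_n ^ 2]. As
    [lambda_n <= zeta_n], each factor of [phi (w * x ^ 2)] is dominated by the corresponding factor
    of [gamma w] on the imaginary axis, so [eta / gamma] is bounded there; it has order less than
    one, hence is constant. Comparing coefficients, [a_j * m_j * b_0 = a_0 * m_0 * b_j]; since
    [m_j] is bounded and [a_j / b_j] tends to [0], all moments vanish, and then so does [y].

    No complex integration is used. Growth is measured by the l1 majorants
    [\sum_j |c_j| * r ^ j], which behave well under division by a linear factor [1 - w / z].
    Hadamard's theorem comes from factoring the Taylor polynomials of the series divided by its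
    small roots: their roots are large and, by a Jensen-type count, have small sum of inverses.
    The Phragmen--Lindelof step is the Bernstein--Walsh inequality applied to Taylor polynomials of
    degree small compared with the length of the segment on which they are bounded. *)

Require Import Defs.
From HB Require Import structures.
From mathcomp Require Import all_boot all_order all_algebra.
From mathcomp Require Import all_classical all_reals all_analysis.
From mathcomp Require Import measurable_realfun.
From mathcomp Require Import complex cyclic separable cyclotomic.
From mathcomp Require Import zify ring lra.
Import Order.TTheory GRing.Theory Num.Theory.
Import numFieldNormedType.Exports.
Local Open Scope classical_set_scope.
Local Open Scope ring_scope.
Local Open Scope complex_scope.

Set Implicit Arguments.
Unset Strict Implicit.
Unset Printing Implicit Defensive.

(** * Moduli and absolutely convergent power series *)

(** The infinite products never appear as such. Their role is played by [quotient_coef_vanish]: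
    after division by the roots up to [2 ^ M], each coefficient of positive index tends to 0 as [M]
    grows. Once [eta] and [gamma] both have this property for the roots [lambda_k ^ 2], both are
    coefficientwise limits of their constant terms times the same finite products, hence
    proportional.

    Nonnegativity of the coefficients links the order to the majorants: the alternating signs cancel
    at [w = - r], so the majorant of [phi] at [r] is the value [f (i * sqrt r)]. As [w = z ^ 2]
    halves the order, the logarithm of the majorant at [2 ^ i] is [O(q ^ i)] with
    [q = 2 ^ (rho / 2) < 2], where [rho < 2] bounds the growth of [f]; the smallness of all tails
    comes from the ratio [q / 2 < 1]. *)

Definition cabs (R : realType) (z : R[i]) : R := complex.Re `|z|.

Section Modulus.
Variable R : realType.
Implicit Types z w : R[i].

Lemma cabsE z : `|z| = (cabs z)%:C.
Proof. by rewrite /cabs normc_def. Qed.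

Lemma cabs_ge0 z : 0 <= cabs z.
Proof. by rewrite -lecR -cabsE normr_ge0. Qed.

Lemma cabsM z w : cabs (z * w) = cabs z * cabs w.
Proof. by apply: complexI; rewrite rmorphM /= -!cabsE normrM. Qed.

Lemma cabsD z w : cabs (z + w) <= cabs z + cabs w.
Proof. by rewrite -lecR rmorphD /= -!cabsE ler_normD. Qed.

Lemma cabsN z : cabs (- z) = cabs z.
Proof. by rewrite /cabs normrN. Qed.

Lemma cabsB z w : cabs (z - w) <= cabs z + cabs w.
Proof. by rewrite -(cabsN w) cabsD. Qed.

Lemma cabsC z w : cabs (z - w) = cabs (w - z).
Proof. by rewrite -cabsN opprB. Qed.

Lemma cabs_sub_ge z w : cabs z - cabs w <= cabs (z - w).
Proof. by rewrite lerBlDr -{1}(subrK w z) cabsD. Qed.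

Lemma cabs0 : cabs (0 : R[i]) = 0.
Proof. by rewrite /cabs normr0. Qed.

Lemma cabs1 : cabs (1 : R[i]) = 1.
Proof. by rewrite /cabs normr1. Qed.

Lemma cabs_eq0 z : (cabs z == 0) = (z == 0).
Proof. by rewrite -(inj_eq (@complexI R)) -cabsE normr_eq0. Qed.

Lemma cabs_gt0 z : (0 < cabs z) = (z != 0).
Proof. by rewrite lt_def cabs_eq0 cabs_ge0 andbT. Qed.

Lemma cabsX z n : cabs (z ^+ n) = cabs z ^+ n.
Proof. by elim: n => [|n IH]; rewrite ?cabs1// !exprS cabsM IH. Qed.

Lemma cabsV z : cabs z^-1 = (cabs z)^-1.
Proof. by apply: complexI; rewrite fmorphV /= -!cabsE normfV. Qed.

Lemma cabs_real (x : R) : cabs x%:C = `|x|.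
Proof. by rewrite /cabs normc_def /= expr0n addr0 sqrtr_sqr. Qed.

Lemma cabs_i : cabs ('i%C : R[i]) = 1.
Proof. by rewrite /cabs normc_def /= expr0n add0r expr1n sqrtr1. Qed.

Lemma cabs_sqr z : cabs z ^+ 2 = complex.Re z ^+ 2 + complex.Im z ^+ 2.
Proof.
by rewrite /cabs normc_def /= sqr_sqrtr// addr_ge0 ?sqr_ge0.
Qed.

Lemma Re_le_cabs z : `|complex.Re z| <= cabs z.
Proof. by rewrite -lecR -cabsE normc_ge_Re. Qed.

Lemma Im_le_cabs z : `|complex.Im z| <= cabs z.
Proof.
rewrite -(ler_pXn2r (n := 2))// ?nnegrE ?cabs_ge0//.
by rewrite cabs_sqr real_normK ?num_real// lerDr sqr_ge0.
Qed.

Lemma cabs_le_ReIm z : cabs z <= `|complex.Re z| + `|complex.Im z|.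
Proof.
rewrite [z in X in X <= _]complexE (le_trans (cabsD _ _))// cabsM cabs_i mul1r.
by rewrite !cabs_real.
Qed.

Lemma cabs_sum (I : Type) (r : seq I) (P : pred I) (F : I -> R[i]) :
  cabs (\sum_(i <- r | P i) F i) <= \sum_(i <- r | P i) cabs (F i).
Proof.
elim/big_rec2: _ => [|i x y _ le]; first by rewrite cabs0.
by rewrite (le_trans (cabsD _ _))// lerD2l.
Qed.

Lemma cabs_small z : (forall e, 0 < e -> cabs z < e) -> z = 0.
Proof.
move=> H; apply/eqP; rewrite -cabs_eq0 eq_le cabs_ge0 andbT.
by apply/ler_addgt0Pr => e /H/ltW; rewrite add0r.
Qed.

End Modulus.

Section PowerSeries.
Variable R : realType.
Local Notation C := R[i].
Implicit Types (c d : nat -> C) (z w : C) (r x : R).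

Definition abs_psum c r (N : nat) : R := \sum_(j < N) cabs (c j) * r ^+ j.
Definition psum c w (N : nat) : C := \sum_(j < N) c j * w ^+ j.
(* Meaningful only for bounded partial sums: [sup] is [0] on unbounded sets. *)
Definition majorant c r : R := sup (range (abs_psum c r)).
Definition entire_coef c :=
  forall r, 0 <= r -> exists B, forall N, abs_psum c r N <= B.
Definition psum_lim c w : C :=
  limn (fun N => complex.Re (psum c w N)) +i*
  limn (fun N => complex.Im (psum c w N)).

Lemma abs_psumS c r N : abs_psum c r N.+1 = abs_psum c r N + cabs (c N) * r ^+ N.
Proof. by rewrite /abs_psum big_ord_recr. Qed.

Lemma psumS c w N : psum c w N.+1 = psum c w N + c N * w ^+ N.
Proof. by rewrite /psum big_ord_recr. Qed.

Lemma abs_psum0 c r : abs_psum c r 0 = 0.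
Proof. by rewrite /abs_psum big_ord0. Qed.

Lemma psum0 c w : psum c w 0 = 0.
Proof. by rewrite /psum big_ord0. Qed.

Lemma abs_psum_ge0 c r N : 0 <= r -> 0 <= abs_psum c r N.
Proof.
by move=> r0; rewrite sumr_ge0// => i _; rewrite mulr_ge0 ?cabs_ge0 ?exprn_ge0.
Qed.

Lemma abs_psum_term_ge0 c r N : 0 <= r -> 0 <= cabs (c N) * r ^+ N.
Proof. by move=> r0; rewrite mulr_ge0 ?cabs_ge0 ?exprn_ge0. Qed.

Lemma abs_psum_leN c r M N : 0 <= r -> (M <= N)%N -> abs_psum c r M <= abs_psum c r N.
Proof.
move=> r0 /subnK <-; elim: (N - M)%N => [|k IH]//.
by rewrite addSn abs_psumS (le_trans IH)// lerDl abs_psum_term_ge0.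
Qed.

Lemma abs_psum_ler c r x N : 0 <= r -> r <= x -> abs_psum c r N <= abs_psum c x N.
Proof.
move=> r0 rx; rewrite ler_sum// => i _; rewrite ler_wpM2l ?cabs_ge0//.
by rewrite lerXn2r// nnegrE (le_trans r0).
Qed.

Lemma psum_le c w N : cabs (psum c w N) <= abs_psum c (cabs w) N.
Proof.
rewrite (le_trans (cabs_sum _ _ _))// ler_sum// => i _.
by rewrite cabsM cabsX.
Qed.

Lemma abs_psum_le_majorant c r N : entire_coef c -> 0 <= r ->
  abs_psum c r N <= majorant c r.
Proof.
move=> ec r0; apply: ub_le_sup; last by exists N.
by have [B HB] := ec r r0; exists B => _ [n _ <-].
Qed.

Lemma majorant_le c r B : (forall N, abs_psum c r N <= B) -> majorant c r <= B.
Proof.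
move=> H; apply: ge_sup; first by exists (abs_psum c r 0); exists 0%N.
by move=> _ [n _ <-].
Qed.

Lemma majorant_ge0 c r : entire_coef c -> 0 <= r -> 0 <= majorant c r.
Proof. by move=> ec r0; rewrite -(abs_psum0 c r) abs_psum_le_majorant. Qed.

Lemma majorant_ler c r x : entire_coef c -> 0 <= r -> r <= x ->
  majorant c r <= majorant c x.
Proof.
move=> ec r0 rx; apply: majorant_le => N.
by rewrite (le_trans (abs_psum_ler c N r0 rx))// abs_psum_le_majorant// (le_trans r0).
Qed.

Lemma coef_le_majorant c r j : entire_coef c -> 0 <= r ->
  cabs (c j) * r ^+ j <= majorant c r.
Proof.
move=> ec r0; rewrite (le_trans _ (abs_psum_le_majorant j.+1 ec r0))//.
by rewrite abs_psumS lerDr abs_psum_ge0.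
Qed.

Lemma coef0_le_majorant c r : entire_coef c -> 0 <= r -> cabs (c 0%N) <= majorant c r.
Proof. by move=> ec r0; have := coef_le_majorant 0 ec r0; rewrite expr0 mulr1. Qed.

(** For [j >= N], enlarging the radius from [r] to [q * r] multiplies the [j]-th term by at least
    [q ^ N], so boundedness alone gives a geometric rate. *)
Lemma psum_tail c w r q B N M : cabs w <= r -> 1 <= q ->
  (forall N, abs_psum c (q * r) N <= B) -> (N <= M)%N ->
  cabs (psum c w M - psum c w N) <= B / q ^+ N.
Proof.
move=> wr q1 HB NM; have r0 : 0 <= r by rewrite (le_trans (cabs_ge0 w)).
have q0 : 0 < q by rewrite (lt_le_trans ltr01).
have qr0 : 0 <= q * r by rewrite mulr_ge0// ltW.
rewrite ler_pdivlMr ?exprn_gt0//.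
apply: (@le_trans _ _ (abs_psum c (q * r) M - abs_psum c (q * r) N)); last first.
  by rewrite lerBlDr (le_trans (HB M))// lerDl abs_psum_ge0.
rewrite -(subnK NM); elim: (M - N)%N => [|k IH].
  by rewrite add0n !subrr cabs0 mul0r.
rewrite addSn psumS abs_psumS.
rewrite [X in cabs X](_ : _ = (psum c w (k + N) - psum c w N) +
  c (k + N)%N * w ^+ (k + N)); last by ring.
rewrite [leRHS](_ : _ = (abs_psum c (q * r) (k + N) - abs_psum c (q * r) N) +
  cabs (c (k + N)%N) * (q * r) ^+ (k + N)); last by ring.
rewrite (le_trans (ler_wpM2r _ (cabsD _ _)))// ?exprn_ge0 ?(ltW q0)//.
rewrite mulrDl lerD// cabsM cabsX -mulrA ler_wpM2l ?cabs_ge0//.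
rewrite exprMn mulrC ler_pM ?exprn_ge0 ?(ltW q0) ?cabs_ge0//.
  by rewrite exprD ler_peMl ?exprn_ge0 ?(ltW q0)// exprn_ege1.
by rewrite lerXn2r// nnegrE cabs_ge0.
Qed.

Lemma cauchy_real_lim (u : nat -> R) (b : nat -> R) : b @ \oo --> (0 : R) ->
  (forall N M, (N <= M)%N -> `|u M - u N| <= b N) ->
  forall N, `|limn u - u N| <= b N.
Proof.
move=> b0 H; have cu : cvgn u.
  apply/cauchy_cvgP/cauchy_exP => e e0.
  have [N _ HN] := proj1 (cvgrPdist_lt _ _) b0 e e0.
  exists (u N); exists N => // M /= NM; rewrite -ball_normE /ball_ /= distrC.
  rewrite (le_lt_trans (H N M NM))//.
  by have := HN N (leqnn N); rewrite /= sub0r normrN; apply: le_lt_trans; exact: ler_norm.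
move=> N; have cuN : (fun M => `|u M - u N|) @ \oo --> `|limn u - u N|.
  by apply: cvg_norm; apply: cvgB => //; exact: cvg_cst.
rewrite -(cvg_lim _ cuN)//; apply: limr_le; first exact: cvgP cuN.
by near=> M; apply: H; near: M; exists N.
Unshelve. all: by end_near. Qed.

Lemma geo_cvg0 (B q : R) : 1 < q -> (fun N => B / q ^+ N) @ \oo --> (0 : R).
Proof.
move=> q1; rewrite -(mulr0 B); apply: cvgM; first exact: cvg_cst.
under eq_fun do rewrite -exprVn.
have q0 : 0 < q by rewrite (lt_trans ltr01).
by apply: cvg_expr; rewrite ger0_norm ?invr_ge0 ?invf_lt1// ltW.
Qed.

Lemma psum_lim_tail2 c w r N : entire_coef c -> cabs w <= r ->
  cabs (psum_lim c w - psum c w N) <= 2 * (majorant c (2 * r) / 2 ^+ N).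
Proof.
move=> ec wr; have r0 : 0 <= r by rewrite (le_trans (cabs_ge0 w)).
have H M N' : (N' <= M)%N -> cabs (psum c w M - psum c w N') <= majorant c (2 * r) / 2 ^+ N'.
  move=> NM; apply: (psum_tail wr) => // [|k]; first by rewrite ler1n.
  by rewrite abs_psum_le_majorant// mulr_ge0.
have b0 : (fun N => majorant c (2 * r) / 2 ^+ N) @ \oo --> (0 : R).
  by apply: geo_cvg0; rewrite ltr1n.
rewrite (le_trans (cabs_le_ReIm _))// mulr2n mulrDl mul1r lerD//.
  have := cauchy_real_lim b0 _ N; move/(_ (fun N => complex.Re (psum c w N))).
  rewrite raddfB /=; apply => N' M NM; rewrite -raddfB.
  by rewrite (le_trans (Re_le_cabs _))// H.
have := cauchy_real_lim b0 _ N; move/(_ (fun N => complex.Im (psum c w N))).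
rewrite raddfB /=; apply => N' M NM; rewrite -raddfB.
by rewrite (le_trans (Im_le_cabs _))// H.
Qed.

Lemma psum_limP c w e : entire_coef c -> 0 < e ->
  exists N0, forall N, (N0 <= N)%N -> cabs (psum_lim c w - psum c w N) < e.
Proof.
move=> ec e0.
have : (fun N => (2 * majorant c (2 * cabs w)) / 2 ^+ N) @ \oo --> (0 : R).
  by apply: geo_cvg0; rewrite ltr1n.
move=> /cvgrPdist_lt /(_ e e0)[N0 _ H]; exists N0 => N /H /=.
rewrite sub0r normrN => He; apply: le_lt_trans He.
rewrite (le_trans (psum_lim_tail2 N ec (lexx _)))// mulrA; exact: ler_norm.
Qed.

Lemma psum_lim_unique c w v : entire_coef c ->
  (forall e, 0 < e -> exists N0, forall N, (N0 <= N)%N -> cabs (v - psum c w N) < e) ->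
  psum_lim c w = v.
Proof.
move=> ec H; apply/eqP; rewrite -subr_eq0; apply/eqP/cabs_small => e e0.
have e2 : 0 < e / 2 by rewrite divr_gt0.
have [N0 H0] := H _ e2; have [N1 H1] := psum_limP w ec e2.
rewrite (_ : psum_lim c w - v =
  (psum_lim c w - psum c w (maxn N0 N1)) - (v - psum c w (maxn N0 N1))); last by ring.
by rewrite (le_lt_trans (cabsB _ _))// [e]splitr ltrD// ?H1 ?H0// ?leq_maxl ?leq_maxr.
Qed.

Lemma psum_lim_tail c w r q N : entire_coef c -> cabs w <= r -> 1 <= q ->
  cabs (psum_lim c w - psum c w N) <= majorant c (q * r) / q ^+ N.
Proof.
move=> ec wr q1; have r0 : 0 <= r by rewrite (le_trans (cabs_ge0 w)).
apply/ler_addgt0Pr => e e0; have [N0 H0] := psum_limP w ec e0.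
rewrite (_ : psum_lim c w - psum c w N = (psum c w (maxn N0 N) - psum c w N) +
  (psum_lim c w - psum c w (maxn N0 N))); last by ring.
rewrite (le_trans (cabsD _ _))// lerD ?(ltW (H0 _ _)) ?leq_maxl//.
apply: (psum_tail wr) => // [k|]; last by rewrite leq_maxr.
by rewrite abs_psum_le_majorant// mulr_ge0// (le_trans ler01).
Qed.

Lemma psum_lim_le c w r : entire_coef c -> cabs w <= r ->
  cabs (psum_lim c w) <= majorant c r.
Proof.
move=> ec wr; have := psum_lim_tail 0 ec wr (lexx 1).
by rewrite psum0 subr0 expr0 divr1 mul1r.
Qed.

(** * Multiplication and division of coefficient sequences by [1 - w / z] *)

Definition mulroot z c : nat -> C :=
  fun j => if j is i.+1 then c i.+1 - c i / z else c 0%N.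

(** Formal division is always possible because [1 - w / z] has constant term 1; that the result is
    entire when [z] is a root is [entire_divroot]. *)
Fixpoint divroot z c j : C :=
  if j is i.+1 then c i.+1 + divroot z c i / z else c 0%N.

Lemma mulrootK z c : mulroot z (divroot z c) = c.
Proof. by apply/funext => -[|j] //=; rewrite addrK. Qed.

Lemma mulrootC z w c : mulroot z (mulroot w c) = mulroot w (mulroot z c).
Proof. by apply/funext => -[|[|j]] //=; ring. Qed.

Lemma psum_mulroot z c w N :
  psum (mulroot z c) w N.+1 = (1 - w / z) * psum c w N + c N * w ^+ N.
Proof.
elim: N => [|N IH]; first by rewrite psumS !psum0 mulr0 !add0r.
by rewrite psumS IH psumS /= exprS; ring.
Qed.

Lemma psum_divroot z c j : z != 0 -> divroot z c j * z ^+ j = psum c z j.+1.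
Proof.
move=> z0; elim: j => [|j IH]; first by rewrite psumS psum0 add0r.
by rewrite psumS -IH /= mulrDl addrC exprS mulrA divfK// mulrC.
Qed.

Lemma abs_psum_mulroot z d x N : z != 0 -> 0 <= x ->
  abs_psum (mulroot z d) x N <= (1 + x / cabs z) * abs_psum d x N.
Proof.
move=> z0 x0; have xz : 0 <= x / cabs z by rewrite divr_ge0 ?cabs_ge0.
(* The product also creates a term of degree [N], outside the partial sum; carrying it along makes
   the induction close. *)
suff : abs_psum (mulroot z d) x N +
    (if N is M.+1 then x / cabs z * (cabs (d M) * x ^+ M) else 0) <=
    (1 + x / cabs z) * abs_psum d x N.
  apply: le_trans; rewrite lerDl; case: N => // M.
  by rewrite mulr_ge0 ?abs_psum_term_ge0.
elim: N => [|[|N] IH]; first by rewrite !abs_psum0 mulr0 addr0.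
  rewrite !abs_psumS !abs_psum0 /= !expr0; lra.
rewrite abs_psumS [X in _ <= _ * X]abs_psumS mulrDr.
rewrite (_ : mulroot z d N.+1 = d N.+1 - d N / z)//.
have : cabs (d N.+1 - d N / z) * x ^+ N.+1 <=
    cabs (d N.+1) * x ^+ N.+1 + x / cabs z * (cabs (d N) * x ^+ N).
  rewrite (le_trans (ler_wpM2r _ (cabsB _ _)))// ?exprn_ge0//.
  by rewrite mulrDl lerD2l cabsM cabsV exprS le_eqVlt; apply/orP; left; apply/eqP; ring.
by move: IH => /=; lra.
Qed.

(** Meant for [r] large against [cabs z], where the part [- w / z] of the factor dominates; it
    raises degrees by one, hence [N.+1] on the right. *)
Lemma abs_psum_mulroot_ge z d r N : 0 <= r ->
  r / cabs z * abs_psum d r N <= abs_psum (mulroot z d) r N.+1 + abs_psum d r N.+1.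
Proof.
move=> r0; elim: N => [|N IH].
  by rewrite abs_psum0 mulr0 addr_ge0 ?abs_psum_ge0.
rewrite abs_psumS mulrDr abs_psumS [X in _ <= _ + X]abs_psumS.
rewrite (_ : mulroot z d N.+1 = d N.+1 - d N / z)//.
have := ler_wpM2r (exprn_ge0 N.+1 r0) (cabs_sub_ge (d N / z) (d N.+1)).
rewrite (cabsC (d N / z)) mulrBl cabsM cabsV exprS; lra.
Qed.

(** The opposite regime, [x] small against [cabs z]: the part 1 of the factor dominates. *)
Lemma abs_psum_mulroot_ge' z d x N : 0 <= x ->
  (1 - x / cabs z) * abs_psum d x N <= abs_psum (mulroot z d) x N.
Proof.
move=> x0; have xz : 0 <= x / cabs z by rewrite divr_ge0 ?cabs_ge0.
suff : abs_psum d x N <= abs_psum (mulroot z d) x N + x / cabs z * abs_psum d x N.-1.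
  have := ler_wpM2l xz (abs_psum_leN d x0 (leq_pred N)); lra.
elim: N => [|N IH]; first by rewrite !abs_psum0 mulr0 addr0.
case: N IH => [|N] IH; first by rewrite !abs_psumS /= !abs_psum0 mulr0 addr0.
rewrite abs_psumS [X in _ <= X + _]abs_psumS [X in _ <= _ + _ * X]abs_psumS mulrDr.
rewrite (_ : mulroot z d N.+1 = d N.+1 - d N / z)//.
have := ler_wpM2r (exprn_ge0 N.+1 x0) (cabs_sub_ge (d N.+1) (d N / z)).
move: IH; rewrite /= mulrBl cabsM cabsV exprS; lra.
Qed.

Lemma entire_mulroot z c : z != 0 -> entire_coef c -> entire_coef (mulroot z c).
Proof.
move=> z0 ec r r0; have [B HB] := ec r r0.
exists ((1 + r / cabs z) * B) => N; rewrite (le_trans (abs_psum_mulroot _ _ z0 r0))//.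
by rewrite ler_wpM2l// addr_ge0// divr_ge0 ?cabs_ge0.
Qed.

Lemma psum_lim_mulroot z c w : z != 0 -> entire_coef c ->
  psum_lim (mulroot z c) w = (1 - w / z) * psum_lim c w.
Proof.
move=> z0 ec; apply: psum_lim_unique; first exact: entire_mulroot.
move=> e e0; set K := cabs (1 - w / z).
have K0 : 0 <= K by exact: cabs_ge0.
pose e' := e / (K + 1) / 2.
have e'0 : 0 < e' by rewrite !divr_gt0// ltr_wpDl.
have [N0 H0] := psum_limP w ec e'0.
have e2 : 0 < e / 2 / 2 by rewrite !divr_gt0.
have [N1 H1] := psum_limP w ec e2.
exists (maxn N0 N1).+1 => -[//|N]; rewrite ltnS geq_max => /andP[N0N N1N].
rewrite psum_mulroot.
rewrite [X in cabs X](_ : _ = (1 - w / z) * (psum_lim c w - psum c w N) +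
   ((psum_lim c w - psum c w N.+1) - (psum_lim c w - psum c w N))); last first.
  by rewrite psumS; ring.
rewrite (le_lt_trans (cabsD _ _))// cabsM -/K [e]splitr ltr_leD//; last first.
  rewrite (le_trans (cabsB _ _))// [leRHS]splitr lerD// ltW// H1//.
  by rewrite (leq_trans N1N).
rewrite (@le_lt_trans _ _ (K * e'))// ?ler_wpM2l ?(ltW (H0 _ _))//.
rewrite /e' mulrA ltr_pM2r ?invr_gt0// mulrA ltr_pdivrMr ?ltr_wpDl//.
by rewrite mulrC ltr_pM2l// ltrDl.
Qed.

Lemma abs_psum_geo c r B N : 0 <= r -> (forall j, cabs (c j) * (2 * r) ^+ j <= B) ->
  abs_psum c r N <= B * (2 - 2 / 2 ^+ N).
Proof.
move=> r0 H; elim: N => [|N IH]; first by rewrite abs_psum0 expr0 divr1 subrr mulr0.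
rewrite abs_psumS (le_trans (lerD IH _) (_ : _ + B / 2 ^+ N <= _))//.
  by rewrite ler_pdivlMr ?exprn_gt0// -mulrA -exprMn mulrC [r * 2]mulrC mulrC.
rewrite exprS invfM; set u := (2 ^+ N)^-1; rewrite le_eqVlt; apply/orP; left; apply/eqP.
by field.
Qed.

(** By [psum_divroot], [divroot z c j * z ^+ j] is a partial sum of [c] at its root [z], hence minus
    a tail, of size [O(q ^- j.+1)]. The choice of [q] makes [q * cabs z >= 2 * r]. *)
Lemma entire_divroot z c : z != 0 -> entire_coef c -> psum_lim c z = 0 ->
  entire_coef (divroot z c).
Proof.
move=> z0 ec cz r r0; have az : 0 < cabs z by rewrite cabs_gt0.
pose q := 1 + 2 * r / cabs z; have q1 : 1 <= q by rewrite lerDl divr_ge0 ?mulr_ge0 ?cabs_ge0.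
set B := majorant c (q * cabs z); exists (B * 2) => N.
have B0 : 0 <= B by rewrite majorant_ge0// mulr_ge0 ?cabs_ge0// (le_trans ler01).
apply: (@le_trans _ _ (B * (2 - 2 / 2 ^+ N))); last first.
  by rewrite ler_wpM2l// gerBl divr_ge0.
apply: abs_psum_geo => // j.
have := psum_lim_tail j.+1 ec (lexx (cabs z)) q1.
rewrite cz sub0r cabsN -psum_divroot// cabsM cabsX -/B => H.
have qj : 0 < q ^+ j.+1 by rewrite exprn_gt0// (lt_le_trans ltr01).
rewrite ler_pdivlMr// in H.
apply: le_trans H; rewrite -mulrA ler_wpM2l ?cabs_ge0//.
have qz : 2 * r <= q * cabs z by rewrite /q [leRHS]mulrDl divfK ?gt_eqF// lerDr mul1r ltW.
rewrite (@le_trans _ _ ((q * cabs z) ^+ j))//.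
  by rewrite lerXn2r// nnegrE ?mulr_ge0 ?cabs_ge0// (le_trans ler01).
rewrite exprMn mulrC ler_wpM2l ?exprn_ge0 ?cabs_ge0// exprS ler_peMl ?exprn_ge0//.
by rewrite (le_trans ler01).
Qed.

Lemma majorant_mulroot_ge z d r : entire_coef d -> z != 0 -> 0 <= r ->
  (r / cabs z - 1) * majorant d r <= majorant (mulroot z d) r.
Proof.
move=> ed z0 r0; have em := entire_mulroot z0 ed.
rewrite mulrBl mul1r lerBlDr.
have [r00|rp] := leP (r / cabs z) 0.
  by rewrite (@le_trans _ _ 0)// ?addr_ge0 ?majorant_ge0// mulr_le0_ge0// majorant_ge0.
rewrite mulrC -ler_pdivlMr//; apply: majorant_le => N.
rewrite ler_pdivlMr// mulrC (le_trans (abs_psum_mulroot_ge _ _ _ r0))//.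
by rewrite lerD// abs_psum_le_majorant.
Qed.

Definition mulroots (s : seq C) c := foldr mulroot c s.

Lemma mulroots_mulroot s z c : mulroots s (mulroot z c) = mulroot z (mulroots s c).
Proof. by elim: s => //= w s ->; rewrite mulrootC. Qed.

Lemma mulroots_cat s t c : mulroots (s ++ t) c = mulroots s (mulroots t c).
Proof. by rewrite /mulroots foldr_cat. Qed.

Lemma mulroots_filter (p : pred C) s c :
  mulroots s c = mulroots [seq z <- s | p z] (mulroots [seq z <- s | ~~ p z] c).
Proof. by elim: s => //= z s ->; case: (p z) => //=; rewrite mulroots_mulroot. Qed.

Lemma mulroots_coef0 s c : mulroots s c 0%N = c 0%N.
Proof. by elim: s. Qed.

Lemma entire_mulroots s c : 0 \notin s -> entire_coef c -> entire_coef (mulroots s c).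
Proof.
elim: s => //= z s IH; rewrite inE negb_or eq_sym => /andP[z0 s0] ec.
by apply: entire_mulroot => //; exact: IH.
Qed.

Lemma psum_lim_mulroots s c w : 0 \notin s -> entire_coef c ->
  psum_lim (mulroots s c) w = \prod_(z <- s) (1 - w / z) * psum_lim c w.
Proof.
elim: s => [|z s IH]; first by rewrite big_nil mul1r.
rewrite inE negb_or eq_sym => /andP[z0 s0] ec; rewrite big_cons /=.
by rewrite psum_lim_mulroot ?IH ?mulrA//; exact: entire_mulroots.
Qed.

Lemma majorant_mulroots_ge3 s d r : 0 \notin s -> entire_coef d -> 0 <= r ->
  {in s, forall z, 4 * cabs z <= r} ->
  3 ^+ size s * majorant d r <= majorant (mulroots s d) r.
Proof.
move=> + ed r0; elim: s => [|z s IH]; first by rewrite mul1r.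
rewrite inE negb_or eq_sym => /andP[z0 s0] H /=.
apply: le_trans (majorant_mulroot_ge _ z0 r0); last exact: entire_mulroots.
rewrite exprS -mulrA ler_pM ?mulr_ge0 ?exprn_ge0 ?majorant_ge0//; last first.
  by apply: IH => // u us; apply: H; rewrite inE us orbT.
rewrite lerBrDr ler_pdivlMr ?cabs_gt0//.
by have := H z (mem_head _ _); lra.
Qed.

(** Used backwards: dividing out roots of modulus at most [r / 2] does not raise the majorant at
    [r]. *)
Lemma majorant_mulroots_ge1 s d r : 0 \notin s -> entire_coef d -> 0 <= r ->
  {in s, forall z, 2 * cabs z <= r} ->
  majorant d r <= majorant (mulroots s d) r.
Proof.
move=> + ed r0; elim: s => [|z s IH]; first by [].
rewrite inE negb_or eq_sym => /andP[z0 s0] H /=.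
apply: le_trans (majorant_mulroot_ge _ z0 r0); last exact: entire_mulroots.
rewrite (@le_trans _ _ (1 * majorant (mulroots s d) r))//.
  by rewrite mul1r; apply: IH => // u us; apply: H; rewrite inE us orbT.
rewrite ler_wpM2r ?majorant_ge0//; first exact: entire_mulroots.
rewrite lerBrDr ler_pdivlMr ?cabs_gt0//.
by have := H z (mem_head _ _); lra.
Qed.

Lemma abs_psum_mulroots s d x N : 0 \notin s -> 0 <= x ->
  abs_psum (mulroots s d) x N <= expR (x * \sum_(z <- s) (cabs z)^-1) * abs_psum d x N.
Proof.
move=> + x0; elim: s => [|z s IH]; first by rewrite big_nil mulr0 expR0 mul1r.
rewrite inE negb_or eq_sym => /andP[z0 s0] /=; rewrite big_cons.
rewrite (le_trans (abs_psum_mulroot _ _ z0 x0))// mulrDr expRD -mulrA ler_pM//.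
- by rewrite addr_ge0// divr_ge0 ?cabs_ge0.
- exact: abs_psum_ge0.
- exact: expR_ge1Dx.
- exact: IH.
Qed.

(** With [y = x / cabs z <= 1 / 2], one factor shrinks the sum at most by [1 - y], and [(1 + 2 * y)
    * (1 - y) = 1 + y * (1 - 2 * y) >= 1], so [expR (2 * y)] makes up for it. *)
Lemma abs_psum_mulroots_ge s d x N : 0 \notin s -> 0 <= x ->
  {in s, forall z, 2 * x <= cabs z} ->
  abs_psum d x N <= expR (2 * x * \sum_(z <- s) (cabs z)^-1) * abs_psum (mulroots s d) x N.
Proof.
move=> + x0; elim: s => [|z s IH]; first by rewrite big_nil mulr0 expR0 mul1r.
rewrite inE negb_or eq_sym => /andP[z0 s0] H /=; rewrite big_cons.
rewrite (le_trans (IH _ _))//; first by move=> u us; apply: H; rewrite inE us orbT.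
rewrite mulrDr expRD [X in _ <= X * _]mulrC -[X in _ <= X]mulrA ler_wpM2l ?expR_ge0//.
set S := abs_psum (mulroots s d) x N.
have S0 : 0 <= S by exact: abs_psum_ge0.
have := abs_psum_mulroot_ge' z (mulroots s d) N x0; rewrite -/S.
set M := abs_psum _ x N => HM.
have zp : 0 < cabs z by rewrite cabs_gt0.
set y := x / cabs z in HM *.
have y2 : 2 * y <= 1 by rewrite /y mulrA ler_pdivrMr// mul1r H// mem_head.
have y0 : 0 <= y by rewrite divr_ge0// ltW.
have := expR_ge1Dx (2 * y); rewrite (_ : 2 * x / cabs z = 2 * y); last by rewrite /y mulrA.
have : 0 <= (1 - 2 * y) * y * S by rewrite mulr_ge0// mulr_ge0// subr_ge0.
have M0 : 0 <= M by exact: abs_psum_ge0.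
move: HM; set E := expR _ => HM HS HE.
have : (1 + 2 * y) * M <= E * M by rewrite ler_wpM2r.
have : (1 + 2 * y) * ((1 - y) * S) <= (1 + 2 * y) * M by rewrite ler_wpM2l//; lra.
lra.
Qed.

End PowerSeries.

(** * Dyadic sums, polynomials and the Bernstein--Walsh inequality *)

Lemma exists_expr_gt (R : realType) (y : R) : exists k : nat, y < 2 ^+ k.
Proof.
exists (Num.bound `|y|); rewrite (le_lt_trans (ler_norm y))//.
by rewrite (lt_trans (archi_boundP _))// -natrX ltr_nat ltn_expl.
Qed.

(** At most [A * q ^ i.+1] entries lie in the shell from [2 ^ i] to [2 ^ i.+1], each with inverse at
    most [2 ^- i]; the shells form a geometric series of ratio [q / 2] starting at [m]. *)
Lemma dyadic_sum (R : realType) (xs : seq R) (A q : R) (m : nat) :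
  0 <= A -> 0 < q -> q < 2 -> {in xs, forall x, 2 ^+ m < x} ->
  (forall i, (m <= i)%N -> (count (fun x => x <= 2 ^+ i) xs)%:R <= A * q ^+ i) ->
  \sum_(x <- xs) x^-1 <= A * q / (1 - q / 2) * (q / 2) ^+ m.
Proof.
move=> A0 q0 q2 Hm Hc; have q1 : 0 < 1 - q / 2 by lra.
have xpos x : x \in xs -> 0 < x by move=> /Hm; apply: le_lt_trans; rewrite exprn_ge0.
have claim k : \sum_(x <- xs | x <= 2 ^+ (m + k)) x^-1 <=
    A * q / (1 - q / 2) * ((q / 2) ^+ m - (q / 2) ^+ (m + k)).
  elim: k => [|k IH].
    rewrite addn0 subrr mulr0 big_seq_cond big1// => x /andP[/Hm xm].
    by rewrite leNgt xm.
  rewrite (bigID (fun x => x <= 2 ^+ (m + k)))/=.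
  rewrite (eq_bigl (fun x => x <= 2 ^+ (m + k))); last first.
    move=> x; rewrite andb_idl// => /le_trans; apply.
    by rewrite ler_weXn2l ?ler1n// addnS.
  have H2 : \sum_(x <- xs | (x <= 2 ^+ (m + k.+1)) && ~~ (x <= 2 ^+ (m + k))) x^-1 <=
      A * q ^+ (m + k).+1 / 2 ^+ (m + k).
    apply: (@le_trans _ _ (\sum_(x <- xs | x <= 2 ^+ (m + k).+1) (2 ^+ (m + k))^-1)).
      rewrite addnS big_seq_cond [leRHS]big_seq_cond.
      rewrite [leRHS](bigID (fun x => x <= 2 ^+ (m + k)))/= ler_wpDl//.
        by rewrite sumr_ge0.
      under [leRHS]eq_bigl do rewrite -andbA.
      rewrite ler_sum// => x /and3P[xs_ _]; rewrite -ltNge => xk.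
      rewrite lef_pV2 ?posrE ?exprn_gt0 ?(xpos _ xs_)//; exact: ltW.
    rewrite big_const_seq iter_addr_0 -[X in X <= _]mulr_natl ler_wpM2r ?invr_ge0 ?exprn_ge0//.
    by rewrite Hc// -addnS leq_addr.
  rewrite (le_trans (lerD IH H2))// le_eqVlt; apply/orP; left; apply/eqP.
  rewrite addnS !exprS !expr_div_n; field.
  by rewrite !expf_neq0 ?pnatr_eq0//= subr_eq0 gt_eqF.
(* The entries are positive, so each is at most their sum and one [k] covers them all. *)
have [k Hk] := exists_expr_gt (\sum_(x <- xs) x).
rewrite big_seq_cond (eq_bigl (fun x => (x \in xs) && (x <= 2 ^+ (m + k)))); last first.
  move=> x /=; rewrite andbT; case xin : (x \in xs) => //=; apply/esym.
  rewrite (@le_trans _ _ (\sum_(x <- xs) x))//.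
    rewrite (big_rem x)//= lerDl big_seq sumr_ge0// => y /mem_rem ys.
    by rewrite ltW// xpos.
  by rewrite (le_trans (ltW Hk))// ler_weXn2l ?ler1n// leq_addl.
rewrite -big_seq_cond (le_trans (claim k))// ler_wpM2l//.
  by rewrite divr_ge0 ?mulr_ge0// ltW.
by rewrite gerBl exprn_ge0// divr_ge0// ltW.
Qed.

Section Polynomials.
Variable R : realType.
Local Notation C := R[i].

Lemma prim_root_exists (F : numClosedFieldType) n : (n > 0)%N -> exists z : F, n.-primitive_root z.
Proof.
pose p : {poly F} := 'X^n - 1; have [r Dp] := closed_field_poly_normal p.
move=> n_gt0; rewrite (monicP _) ?monicXnsubC // scale1r in Dp.
have rn1: all n.-unity_root r by apply/allP=> z; rewrite -root_prod_XsubC -Dp.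
have sz_r: (n < (size r).+1)%N.
  by rewrite -(size_prod_XsubC r id) -Dp size_XnsubC.
have [|z] := hasP (has_prim_root n_gt0 rn1 _ sz_r); last by exists z.
by rewrite -separable_prod_XsubC -Dp separable_Xn_sub_1 // pnatr_eq0 -lt0n.
Qed.

Lemma sum_prim_root (F : fieldType) (z : F) N k : N.-primitive_root z ->
  \sum_(l < N) (z ^+ k) ^+ l = if (N %| k)%N then N%:R else 0.
Proof.
move=> pz; rewrite (prim_order_dvd pz); have [->|nz] := eqVneq (z ^+ k) 1.
  under eq_bigr do rewrite expr1n.
  by rewrite sumr_const card_ord.
apply: (mulfI (_ : z ^+ k - 1 != 0)); first by rewrite subr_eq0.
rewrite -subrX1 -exprM mulnC exprM (prim_expr_order pz) expr1n subrr.
by rewrite ?mulr0.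
Qed.

(** Averaging over the [N]-th roots of unity replaces the contour integral and is exact for
    polynomials of degree below [N]. *)
Lemma cauchy_coef (c : nat -> C) N (r B : R) j : 0 <= r ->
  (forall w, cabs w = r -> cabs (psum c w N) <= B) -> (j < N)%N ->
  cabs (c j) * r ^+ j <= B.
Proof.
move=> r0 H jN; have N0 : (0 < N)%N by case: N jN {H}.
have [z pz] := prim_root_exists C N0.
have az : cabs z = 1.
  apply/eqP; rewrite -(@pexpr_eq1 _ (cabs z) N) ?cabs_ge0 -?lt0n//.
  by rewrite -cabsX (prim_expr_order pz) cabs1.
(* [N - j] stands for the exponent [- j] modulo [N]. *)
have key : \sum_(l < N) psum c (r%:C * z ^+ l) N * (z ^+ (N - j)) ^+ l = N%:R * (c j * r%:C ^+ j).
  have E i l : c i * (r%:C * z ^+ l) ^+ i * (z ^+ (N - j)) ^+ l =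
      c i * r%:C ^+ i * (z ^+ (i + (N - j))) ^+ l.
    by rewrite exprMn exprD exprMn (exprAC z l i); ring.
  rewrite /psum; under eq_bigr do rewrite mulr_suml.
  rewrite exchange_big /=.
  under eq_bigr => i _.
    under eq_bigr do rewrite E.
    rewrite -mulr_sumr (sum_prim_root _ pz).
    over.
  rewrite (bigD1 (Ordinal jN))//= subnKC ?(ltnW jN)// dvdnn mulrC big1 ?addr0//.
  move=> i ij; case: ifP => [|_]; last by rewrite mulr0.
  (* The exponent [i + (N - j)] lies strictly between 0 and [2 * N], so divisibility by [N] would
     force [i = j]. *)
  move=> /dvdnP[k Hk]; exfalso; move/negP: ij; apply; apply/eqP/val_inj => /=.
  have iN := ltn_ord i.
  have : (0 < i + (N - j) < 2 * N)%N by rewrite addn_gt0 subn_gt0 jN orbT /=; lia.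
  rewrite Hk => /andP[]; case: k Hk => [|[|k]]; rewrite ?mul1n ?mul0n//; first lia.
  by move=> _ _; rewrite !mulSn; lia.
have := cabs_sum (index_enum 'I_N) xpredT (fun l : 'I_N => psum c (r%:C * z ^+ l) N * (z ^+ (N - j)) ^+ l).
rewrite key cabsM cabsM cabsX cabs_real ger0_norm// => /le_trans le.
have NR : cabs (N%:R : C) = N%:R.
  by rewrite -(rmorph_nat (real_complex R)) cabs_real ger0_norm.
rewrite NR in le.
have : N%:R * (cabs (c j) * r ^+ j) <= N%:R * B.
  apply: le; rewrite [leRHS](_ : _ = \sum_(l < N) B); last by rewrite sumr_const card_ord mulr_natl.
  rewrite ler_sum// => l _.
  rewrite cabsM !cabsX az !expr1n mulr1 H// cabsM cabsX az expr1n mulr1 cabs_real.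
  by rewrite ger0_norm.
by rewrite ler_pM2l// ltr0n.
Qed.

Lemma horner_psum (p : {poly C}) w N : (size p <= N)%N -> p.[w] = psum (nth 0 p) w N.
Proof. by move=> pN; rewrite (horner_coef_wide w pN). Qed.

Lemma linear_exp_bound (y B : R) (N : nat) : 0 <= y -> 0 <= B ->
  (forall k, y ^+ k <= (k * N).+1%:R * B ^+ k) -> y <= B.
Proof.
move=> y0 B0 H; rewrite leNgt; apply/negP => By.
have [B00|Bn0] := eqVneq B 0.
  have := H 1%N; rewrite B00 !expr1 mulr0 => y00; by move: By; rewrite B00 ltNge y00.
have Bp : 0 < B by rewrite lt_def Bn0.
pose t := y / B; have t1 : 1 < t by rewrite ltr_pdivlMr// mul1r.
pose e := t - 1; have e0 : 0 < e by rewrite subr_gt0.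
have Ht k : t ^+ k <= (k * N).+1%:R.
  by rewrite expr_div_n ler_pdivrMr ?exprn_gt0.
have bern k : 1 + k%:R * e <= t ^+ k.
  elim: k => [|k IH]; first by rewrite mul0r addr0.
  rewrite exprS -natr1; have : t * (1 + k%:R * e) <= t * t ^+ k by rewrite ler_wpM2l// ltW// (lt_trans ltr01).
  have : 0 <= k%:R * (e * e) by rewrite !mulr_ge0// ltW.
  rewrite (_ : t = 1 + e); last by rewrite /e; ring.
  lra.
(* At the exponent [2 * K], Bernoulli applied to [t ^ K] gives a lower bound [(K * e) ^ 2],
   quadratic in [K], against an upper bound linear in [K]; this [K] makes them clash. *)
pose K := (Num.bound ((2 * N).+1%:R / (e * e) : R)).+1.
have HK : (2 * N).+1%:R / (e * e) < K%:R.
  rewrite (lt_trans (archi_boundP _))// ?divr_ge0 ?mulr_ge0// ?ltr_nat ?ltnSn// ltW//.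
rewrite ltr_pdivrMr ?mulr_gt0// in HK.
have := Ht (K * 2)%N; rewrite exprM => HT.
have K1 : 1 <= K%:R :> R by rewrite ler1n.
have h1 : K%:R * e <= t ^+ K by rewrite (le_trans _ (bern K))// lerDr.
have Ke : 0 <= K%:R * e by rewrite mulr_ge0// ltW.
have h2 : (K%:R * e) ^+ 2 <= (K * 2 * N).+1%:R.
  by rewrite (le_trans _ HT)// lerXn2r// nnegrE// exprn_ge0// ltW// (lt_trans ltr01).
have h3 : (K * 2 * N).+1%:R <= K%:R * (2 * N).+1%:R :> R.
  have K0 : (0 < K)%N by [].
  by rewrite -natrM ler_nat -mulnA ltn_pmul2l.
have h4 : K%:R * (2 * N).+1%:R < K%:R * (K%:R * (e * e)) by rewrite ltr_pM2l.
by move: h2 h3 h4; rewrite exprMn; set a := K%:R; set b := _%:R; set c := _ * _.+1%:R; lra.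
Qed.

(* Cauchy's coefficient bound loses a factor [size p]; applying it to all powers of [p] removes it. *)
Lemma poly_max_principle (p : {poly C}) (B : R) v :
  (forall u, cabs u = 1 -> cabs p.[u] <= B) -> cabs v <= 1 -> cabs p.[v] <= B.
Proof.
move=> H v1; have B0 : 0 <= B by rewrite (le_trans (cabs_ge0 _) (H 1 (cabs1 R))).
apply: (@linear_exp_bound _ _ (size p)) => //; first exact: cabs_ge0.
move=> k; have sz : (size (p ^+ k) <= (k * size p).+1)%N.
  rewrite (leq_trans (size_poly_exp_leq _ _))// ltnS mulnC leq_mul2l.
  by rewrite leq_pred orbT.
rewrite -cabsX -horner_exp (horner_psum v sz) (le_trans (psum_le _ _ _))//.
rewrite [leRHS](_ : _ = \sum_(l < (k * size p).+1) B ^+ k); last by rewrite sumr_const card_ord mulr_natl.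
rewrite ler_sum// => j _.
apply: (@le_trans _ _ (cabs (p ^+ k)`_j * 1 ^+ j)).
  by rewrite ler_wpM2l ?cabs_ge0// lerXn2r// nnegrE ?cabs_ge0.
apply: (@cauchy_coef (nth 0 (p ^+ k)) (k * size p).+1) => // u u1.
by rewrite -(horner_psum u sz) horner_exp cabsX lerXn2r ?nnegrE ?cabs_ge0// H.
Qed.

(* Joukowski substitution: [v ^ N * p (r / 2 * (v + v^-1))] is a polynomial in [v], bounded by [B] on
   the unit circle, where [v + v^-1] is real. *)
Lemma bernstein_walsh (p : {poly C}) (N : nat) (r B : R) w : (size p <= N.+1)%N -> 0 < r ->
  (forall x : R, `|x| <= r -> cabs p.[x%:C] <= B) ->
  cabs p.[w] <= B * (1 + 2 * cabs w / r) ^+ N.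
Proof.
move=> sz r0 H.
pose Q : {poly C} := \sum_(j < N.+1) (p`_j * (r%:C / 2) ^+ j) *: (('X^2 + 1) ^+ j * 'X^(N - j)).
have HQ v : v != 0 -> Q.[v] = v ^+ N * p.[r%:C / 2 * (v + v^-1)].
  move=> v0; rewrite (horner_coef_wide _ sz) horner_sum mulr_sumr.
  apply: eq_bigr => j _; rewrite hornerZ hornerM horner_exp hornerD !hornerXn hornerC.
  have jN : (j <= N)%N by rewrite -ltnS.
  have -> : v ^+ N = v ^+ (N - j) * v ^+ j by rewrite -exprD subnK.
  rewrite (_ : v + v^-1 = (v ^+ 2 + 1) / v); last by field.
  rewrite [in RHS]exprMn [(_ / v) ^+ j]exprMn exprVn; set e := (_ + 1) ^+ _.
  have : v ^+ j != 0 by rewrite expf_neq0.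
  move: (v ^+ j) (v ^+ (N - j)) ((r%:C / 2) ^+ j) => vj vn rj vj0; field.
  exact: vj0.
pose u := w / r%:C; pose s := sqrtc (u ^+ 2 - 1).
(* [u + s] and [u - s] are the two solutions [v] of [v + v^-1 = 2 * u]; their product is 1, so one
   of them lies in the closed unit disk. *)
have hs : (u + s) * (u - s) = 1 by rewrite mulrC -subr_sqr sqr_sqrtc; ring.
have [v [v0 v1 vu]] : exists v, [/\ v != 0, cabs v <= 1 & v + v^-1 = 2 * u].
  have n1 : u + s != 0 by apply/eqP => h; move: hs; rewrite h mul0r => /esym/eqP; rewrite oner_eq0.
  have n2 : u - s != 0 by apply/eqP => h; move: hs; rewrite h mulr0 => /esym/eqP; rewrite oner_eq0.
  have [le|lt] := leP (cabs (u + s)) 1.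
    exists (u + s); split => //.
    have -> : (u + s)^-1 = u - s by apply: (mulfI n1); rewrite mulfV// hs.
    ring.
  exists (u - s); split => //.
    have := cabsM (u + s) (u - s); rewrite hs cabs1 => h.
    by rewrite -(ler_pM2l (lt_trans ltr01 lt)) -h mulr1 ltW.
  have -> : (u - s)^-1 = u + s by apply: (mulIf n2); rewrite mulVf// hs.
  ring.
have rC0 : r%:C != 0 :> C by rewrite fmorph_eq0 gt_eqF.
have Hw : r%:C / 2 * (v + v^-1) = w by rewrite vu /u; field.
have QB : cabs Q.[v] <= B.
  apply: poly_max_principle => // z z1.
  have z0 : z != 0 by rewrite -cabs_gt0 z1.
  rewrite HQ// cabsM cabsX z1 expr1n mul1r.
  have zc : z^-1 = (z^*)%C by rewrite invc_norm cabsE z1 expr1n invr1 mul1r.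
  have -> : r%:C / 2 * (z + z^-1) = (r * complex.Re z)%:C.
    by rewrite zc addcJ rmorphM /=; field.
  apply: H; rewrite normrM gtr0_norm// ger_pMr// -z1; exact: Re_le_cabs.
have vp : 0 < cabs v by rewrite cabs_gt0.
rewrite HQ// Hw cabsM cabsX mulrC -ler_pdivlMr ?exprn_gt0// in QB.
have B0 : 0 <= B by rewrite (le_trans (cabs_ge0 _) (H 0 _))// normr0 ltW.
rewrite (le_trans QB)// ler_wpM2l// -exprVn lerXn2r// ?nnegrE ?invr_ge0 ?cabs_ge0//.
  by rewrite addr_ge0// divr_ge0 ?mulr_ge0 ?cabs_ge0// ltW.
rewrite -cabsV (_ : v^-1 = 2 * u - v); last by rewrite -vu; ring.
rewrite (le_trans (cabsB _ _))// addrC lerD// cabsM /u cabsM cabsV cabs_real gtr0_norm//.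
by rewrite (_ : cabs (2 : C) = 2) ?mulrA// -(rmorph_nat (real_complex R)) cabs_real ger0_norm.
Qed.

Lemma bernstein_walsh_imaginary (c : nat -> C) (N : nat) (r B : R) w : 0 < r ->
  (forall x : R, `|x| <= r -> cabs (psum c (x%:C * 'i%C) N.+1) <= B) ->
  cabs (psum c w N.+1) <= B * (1 + 2 * cabs w / r) ^+ N.
Proof.
move=> r0 H; pose p : {poly C} := \poly_(j < N.+1) (c j * 'i%C ^+ j).
have sz : (size p <= N.+1)%N by exact: size_poly.
have Hp z : p.[z] = psum c (z * 'i%C) N.+1.
  rewrite (horner_coef_wide _ sz); apply: eq_bigr => j _.
  by rewrite coef_poly ltn_ord exprMn; ring.
have i2 : 'i%C * 'i%C = -1 :> C by rewrite -expr2 sqr_i.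
have -> : psum c w N.+1 = p.[- 'i%C * w].
  by rewrite Hp; congr psum; rewrite -mulrA [w * _]mulrC mulrA mulNr i2 opprK mul1r.
have -> : cabs w = cabs (- 'i%C * w) by rewrite cabsM cabsN cabs_i mul1r.
by apply: bernstein_walsh => // x /H; rewrite -Hp.
Qed.

End Polynomials.

(** * Dividing out roots, and Hadamard products *)

Section Roots.
Variable R : realType.
Local Notation C := R[i].

Lemma entire_coef_le (c d : nat -> C) : (forall j, cabs (c j) <= cabs (d j)) ->
  entire_coef d -> entire_coef c.
Proof.
move=> H ed r r0; have [B HB] := ed r r0; exists B => N.
by rewrite (le_trans _ (HB N))// ler_sum// => i _; rewrite ler_wpM2r ?exprn_ge0.
Qed.

Lemma majorant_le_coef (c d : nat -> C) r : (forall j, cabs (c j) <= cabs (d j)) ->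
  entire_coef d -> 0 <= r -> majorant c r <= majorant d r.
Proof.
move=> H ed r0; apply: majorant_le => N.
rewrite (le_trans _ (abs_psum_le_majorant N ed r0))// ler_sum// => i _.
by rewrite ler_wpM2r ?exprn_ge0.
Qed.

(** The factor [j] natural in an estimate of [z ^ j - w ^ j] is absorbed into [2 ^ j], that is, into
    doubling the radius. *)
Lemma psum_lipschitz (c : nat -> C) (r : R) z w N : 0 < r -> cabs z <= r -> cabs w <= r ->
  cabs (psum c z N - psum c w N) <= cabs (z - w) / r * abs_psum c (2 * r) N.
Proof.
move=> r0 zr wr; set dl := cabs (z - w).
have H j : cabs (z ^+ j - w ^+ j) <= dl / r * (2 * r) ^+ j.
  elim: j => [|j IH].
    by rewrite !expr0 subrr cabs0 mulr1 divr_ge0 ?cabs_ge0// ltW.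
  rewrite (_ : z ^+ j.+1 - w ^+ j.+1 = z * (z ^+ j - w ^+ j) + (z - w) * w ^+ j); last first.
    by rewrite !exprS; ring.
  rewrite (le_trans (cabsD _ _))// !cabsM cabsX -/dl.
  have h1 : cabs z * cabs (z ^+ j - w ^+ j) <= r * (dl / r * (2 * r) ^+ j).
    by rewrite ler_pM ?cabs_ge0.
  have h2 : dl * cabs w ^+ j <= dl * (2 * r) ^+ j.
    rewrite ler_wpM2l ?cabs_ge0// lerXn2r ?nnegrE ?cabs_ge0 ?mulr_ge0 ?(ltW r0)//.
    by rewrite (le_trans wr)// ler_peMl ?ler1n// ltW.
  rewrite (le_trans (lerD h1 h2))// exprS le_eqVlt; apply/orP; left; apply/eqP; field.
  by rewrite gt_eqF.
rewrite /psum -sumrB (le_trans (cabs_sum _ _ _))// mulr_sumr ler_sum// => j _.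
by rewrite -mulrBr cabsM mulrCA ler_wpM2l ?cabs_ge0.
Qed.

Lemma psum_lim_lipschitz (c : nat -> C) (r : R) z w : entire_coef c -> 0 < r ->
  cabs z <= r -> cabs w <= r ->
  cabs (psum_lim c z - psum_lim c w) <= cabs (z - w) / r * majorant c (2 * r).
Proof.
move=> ec r0 zr wr; apply/ler_addgt0Pr => e e0.
have e2 : 0 < e / 2 by rewrite divr_gt0.
have [N0 H0] := psum_limP z ec e2; have [N1 H1] := psum_limP w ec e2.
have := H0 _ (leq_maxl N0 N1); have := H1 _ (leq_maxr N0 N1).
set N := maxn N0 N1 => wN zN.
have L : cabs (psum c z N - psum c w N) <= cabs (z - w) / r * majorant c (2 * r).
  rewrite (le_trans (psum_lipschitz _ _ r0 zr wr))// ler_wpM2l ?divr_ge0 ?cabs_ge0 ?(ltW r0)//.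
  by rewrite abs_psum_le_majorant// mulr_ge0// ltW.
move: zN wN L; move: (psum c z N) (psum c w N) (psum_lim c z) (psum_lim c w) => s t u v us vt L.
rewrite (_ : u - v = (s - t) + ((u - s) - (v - t))); last by ring.
rewrite (le_trans (cabsD _ _))// lerD// (le_trans (cabsB _ _))// [e]splitr.
by rewrite lerD// ltW.
Qed.

Lemma complex_bolzano_weierstrass (z : nat -> C) (r : R) : (forall k, cabs (z k) <= r) ->
  exists w, forall e, 0 < e -> forall K, exists2 k, (K <= k)%N & cabs (w - z k) < e.
Proof.
move=> zr.
have bnd (u : nat -> R) : (forall k, `|u k| <= r) -> bounded_fun u.
  move=> ur; exists r; split; first exact: num_real.
  by move=> x rx k _; rewrite /= (le_trans (ur k))// ltW.
have [|f1 i1 cf1] := @bolzano_weierstrass R (fun k => complex.Re (z k)).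
  by apply: bnd => k; rewrite (le_trans (Re_le_cabs _)).
have [|f2 i2 cf2] := @bolzano_weierstrass R (fun k => complex.Im (z (f1 k))).
  by apply: bnd => k; rewrite (le_trans (Im_le_cabs _)).
have incr (f : nat -> nat) : increasing_seq f -> forall k, (k <= f k)%N.
  move=> fi; elim=> // k IH; rewrite (leq_ltn_trans IH)//.
  by have := fi k.+1 k; rewrite !leEnat ltnn => h; rewrite ltnNge h.
set a := limn _ in cf1; set b := limn _ in cf2.
exists (a +i* b) => e e0 K.
have e2 : 0 < e / 2 by rewrite divr_gt0.
have [N1 _ H1] := proj1 (cvgrPdist_lt _ _) cf1 _ e2.
have [N2 _ H2] := proj1 (cvgrPdist_lt _ _) cf2 _ e2.
pose M := maxn K (maxn N1 N2); exists (f1 (f2 M)).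
  by rewrite (leq_trans _ (incr _ i1 _))// (leq_trans _ (incr _ i2 _))// leq_maxl.
rewrite (le_lt_trans (cabs_le_ReIm _))// [e]splitr !raddfB /= ltrD//.
  by apply: H1 => /=; rewrite (leq_trans _ (incr _ i2 _))// !leq_max leqnn orbT.
by apply: H2 => /=; rewrite !leq_max leqnn !orbT.
Qed.

(** Half of Hurwitz's theorem, by compactness: zeros in the disk of Taylor polynomials of unbounded
    degree would accumulate at a zero of the sum. *)
Lemma psum_zero_free (d : nat -> C) (r : R) : entire_coef d -> 0 < r ->
  (forall w, cabs w <= r -> psum_lim d w != 0) ->
  exists N0, forall N, (N0 <= N)%N -> forall w, cabs w <= r -> psum d w N != 0.
Proof.
move=> ed r0 H; apply: contrapT => /forallNP H'.
have /choice[z Hz] : forall N0, exists w, cabs w <= r /\ exists2 N, (N0 <= N)%N & psum d w N = 0.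
  move=> N0; have /existsNP[N /not_implyP[NN /existsNP[w /not_implyP[wr /negP/negPn/eqP dw]]]] := H' N0.
  by exists w; split => //; exists N.
have zr k : cabs (z k) <= r by have [] := Hz k.
have [w Hw] := complex_bolzano_weierstrass zr.
have wr : cabs w <= r.
  apply/ler_addgt0Pr => e e0; have [k _ Hk] := Hw e e0 0%N.
  by rewrite -[w](subrK (z k)) (le_trans (cabsD _ _))// addrC lerD// ltW.
move/negP: (H w wr); apply; apply/eqP; apply: cabs_small => e e0.
set B := majorant d (2 * r).
have B0 : 0 <= B by rewrite majorant_ge0// mulr_ge0// ltW.
have cB : (fun N => B / 2 ^+ N) @ \oo --> (0 : R) by apply: geo_cvg0; rewrite ltr1n.
have e2 : 0 < e / 2 by rewrite divr_gt0.
have [K _ HK] := proj1 (cvgrPdist_lt _ _) cB _ e2.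
have e3 : 0 < e / 2 * r / (B + 1) by rewrite divr_gt0 ?mulr_gt0// ltr_wpDl.
have [k Kk Hk] := Hw _ e3 K.
have [zk [N kN dN]] := Hz k.
rewrite -[psum_lim d w](subrK (psum_lim d (z k))) (le_lt_trans (cabsD _ _))//.
rewrite [e]splitr ltr_leD//.
  rewrite (le_lt_trans (psum_lim_lipschitz ed r0 wr zk))// -/B.
  rewrite mulrAC ltr_pdivrMr// (@le_lt_trans _ _ (e / 2 * r / (B + 1) * B))//.
    by rewrite ler_wpM2r// ltW.
  rewrite mulrAC ltr_pdivrMr ?ltr_wpDl// ltr_pM2l ?mulr_gt0//.
  by rewrite ltrDl.
have := psum_lim_tail N ed zk (_ : 1 <= 2); rewrite ler1n => /(_ isT).
rewrite dN subr0 -/B => /le_trans; apply.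
apply: ltW; apply: le_lt_trans (HK N _); last by rewrite /= (leq_trans Kk).
by rewrite sub0r normrN ler_norm.
Qed.

Definition truncate (d : nat -> C) N j : C := if (j < N)%N then d j else 0.

Lemma mulroot_poly (p : {poly C}) z : nth 0 (p * (1 - z^-1 *: 'X)) = mulroot z (nth 0 p).
Proof.
apply/funext => j; rewrite mulrBr mulr1 -scalerAr coefB coefZ coefMX.
by case: j => [|j] /=; rewrite ?mulr0 ?subr0// mulrC.
Qed.

(** With factors normalised as [1 - w / z], which [d 0 != 0] permits, the remaining constant is
    [d 0], whatever the degree. *)
Lemma truncate_roots (d : nat -> C) N : (0 < N)%N -> d 0%N != 0 ->
  exists s, [/\ 0 \notin s, {in s, forall z, psum d z N = 0} &
    truncate d N = mulroots s (fun j => if j is 0%N then d 0%N else 0)].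
Proof.
move=> N0 d0; pose p : {poly C} := \poly_(j < N) d j.
have [s Hs] := closed_field_poly_normal p.
have pz z : p.[z] = psum d z N.
  by rewrite (horner_psum _ (size_poly _ _)); apply: eq_bigr => j _; rewrite coef_poly ltn_ord.
have p0 : p != 0.
  by apply/eqP => h; move: d0; have := coef_poly N d 0; rewrite -/p h coef0 N0 => <-; rewrite eqxx.
have rs z : z \in s -> p.[z] = 0.
  move=> zs; apply/eqP; rewrite -/(root p z) Hs rootZ ?lead_coef_eq0//.
  by rewrite root_prod_XsubC.
have s0 : 0 \notin s.
  apply/negP => /rs; rewrite horner_coef0 coef_poly N0 => /eqP; exact/negP.
exists s; split => //; first by move=> z zs; rewrite -pz rs.
have -> : truncate d N = nth 0 p by apply/funext => j; rewrite coef_poly.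
have key t : 0 \notin t -> exists a : C, \prod_(z <- t) ('X - z%:P) = a *: \prod_(z <- t) (1 - z^-1 *: 'X).
  elim: t => [|z t IH]; first by exists 1; rewrite !big_nil scale1r.
  rewrite inE negb_or eq_sym => /andP[z0 /IH[a Ha]].
  exists (- z * a); rewrite !big_cons Ha.
  have -> : 'X - z%:P = - z *: (1 - z^-1 *: 'X).
    by rewrite scalerBr scalerA mulNr divff// scaleN1r opprK addrC scaleNr alg_polyC.
  by rewrite -scalerAl -scalerAr scalerA.
have [a Ha] := key s s0.
have pE : p = (d 0%N)%:P * \prod_(z <- s) (1 - z^-1 *: 'X).
  have h : p = (lead_coef p * a) *: \prod_(z <- s) (1 - z^-1 *: 'X).
    by rewrite {1}Hs Ha scalerA.
  have : p`_0 = d 0%N by rewrite coef_poly N0.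
  rewrite [in p`_0]h coefZ -horner_coef0 horner_prod big1 ?mulr1; last first.
    by move=> z _; rewrite hornerD hornerN hornerZ hornerX mulr0 oppr0 hornerC addr0.
  by move=> <-; rewrite {1}h mul_polyC.
rewrite pE; elim: s {Hs rs s0 Ha pE} => [|z s IH].
  by rewrite big_nil mulr1; apply/funext => -[|j]; rewrite coefC.
by rewrite big_cons mulrCA mulrC mulroot_poly IH.
Qed.

(* Jensen-type count: dividing out a root of modulus at most [r] shrinks the majorant at [4 * r]
   by a factor three, while the constant coefficient does not change. *)
Lemma count_roots (c d : nat -> C) (s : seq C) (r E : R) : 0 \notin s -> entire_coef d ->
  c = mulroots s d -> c 0%N != 0 -> 0 <= r ->
  majorant c (4 * r) <= cabs (c 0%N) * expR E ->
  (count (fun z => cabs z <= r) s)%:R <= E / ln 3.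
Proof.
move=> s0 ed cE c0 r0 H.
have l3 : 0 < ln 3 :> R by rewrite ln_gt0// ltr1n.
have r4 : 0 <= 4 * r by rewrite mulr_ge0.
pose s1 := [seq z <- s | cabs z <= r]; pose s2 := [seq z <- s | ~~ (cabs z <= r)].
have s10 : 0 \notin s1 by rewrite mem_filter (negbTE s0) andbF.
have s20 : 0 \notin s2 by rewrite mem_filter (negbTE s0) andbF.
have ed2 := entire_mulroots s20 ed.
rewrite -size_filter -/s1 ler_pdivlMr// -ler_expR mulr_natl.
rewrite -lnXn// lnK ?posrE ?exprn_gt0//.
rewrite -(ler_pM2l (_ : 0 < cabs (c 0%N))) ?cabs_gt0//; apply: le_trans H.
rewrite {2}cE (mulroots_filter (fun z => cabs z <= r)) mulrC.
apply: le_trans (majorant_mulroots_ge3 s10 ed2 r4 _); last first.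
  by move=> z; rewrite mem_filter => /andP[zr _]; rewrite ler_wpM2l.
rewrite ler_wpM2l ?exprn_ge0// (_ : c 0%N = mulroots s2 d 0%N); last first.
  by rewrite cE !mulroots_coef0.
exact: coef0_le_majorant.
Qed.

(** * Division by the roots of an increasing positive sequence *)

Section Quotients.
Variable xi : nat -> R.
Hypothesis xi_gt0 : forall k, 0 < xi k.
Hypothesis xi_incr : {homo xi : m n / (m < n)%N >-> m < n}.

Definition real_roots n : seq C := [seq (xi k)%:C | k <- iota 0 n].

Fixpoint quotient (c : nat -> C) n : nat -> C :=
  if n is k.+1 then divroot (xi k)%:C (quotient c k) else c.

Lemma real_roots_neq0 n : 0 \notin real_roots n.
Proof.
apply/negP => /mapP[k _ /eqP]; rewrite eq_sym fmorph_eq0 => /eqP h.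
by have := xi_gt0 k; rewrite h ltxx.
Qed.

Lemma xi_neq0 k : (xi k)%:C != 0 :> C.
Proof. by rewrite fmorph_eq0 gt_eqF. Qed.

Lemma real_rootsS n : real_roots n.+1 = real_roots n ++ [:: (xi n)%:C].
Proof. by rewrite /real_roots -addn1 iotaD map_cat add0n. Qed.

Lemma quotientK c n : mulroots (real_roots n) (quotient c n) = c.
Proof.
by elim: n => // n IH; rewrite real_rootsS mulroots_cat /= mulrootK.
Qed.

Lemma quotient_coef0 c n : quotient c n 0%N = c 0%N.
Proof. by rewrite -[in RHS](quotientK c n) mulroots_coef0. Qed.

Lemma xi_inj : injective xi.
Proof.
move=> i j ij; have [ij'|ij'|//] := ltngtP i j; have := xi_incr ij'; by rewrite ij ltxx.
Qed.

(** The [xi k] are distinct, so the factors already divided out do not vanish at [xi n], which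
    remains a root of the quotient. *)
Lemma entire_quotient c n : entire_coef c -> (forall k, psum_lim c (xi k)%:C = 0) ->
  entire_coef (quotient c n).
Proof.
move=> ec H; elim: n => //= n IH; apply: entire_divroot => //; first exact: xi_neq0.
have := H n; rewrite -[X in psum_lim X _](quotientK c n) psum_lim_mulroots ?real_roots_neq0//.
move/eqP; rewrite mulf_eq0 => /orP[|/eqP//]; rewrite prodf_seq_eq0 => /hasP[z /mapP[k]].
rewrite mem_iota => /andP[_ kn] -> /=; rewrite subr_eq0.
move=> /eqP/(congr1 (fun u => u * (xi k)%:C)); rewrite mul1r divfK ?xi_neq0//.
by move=> /complexI/xi_inj nk; move: kn; rewrite nk add0n ltnn.
Qed.

Lemma psum_lim_quotient c n w : entire_coef c -> (forall k, psum_lim c (xi k)%:C = 0) ->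
  psum_lim c w = \prod_(z <- real_roots n) (1 - w / z) * psum_lim (quotient c n) w.
Proof.
move=> ec H; rewrite -{1}(quotientK c n) psum_lim_mulroots ?real_roots_neq0//.
exact: entire_quotient.
Qed.

Lemma sum_inv_roots n : \sum_(z <- real_roots n) (cabs z)^-1 = \sum_(k < n) (xi k)^-1.
Proof.
rewrite big_map -[in LHS](subn0 n) -/(index_iota 0 n) big_mkord.
by apply: eq_bigr => k _; rewrite cabs_real gtr0_norm.
Qed.

Section Hadamard.
Variables (c : nat -> C) (A q : R).
Hypothesis ec : entire_coef c.
Hypothesis c0 : c 0%N != 0.
Hypothesis A0 : 0 <= A.
Hypothesis q1 : 1 <= q.
Hypothesis q2 : q < 2.
Hypothesis growth : forall i, majorant c (2 ^+ i) <= cabs (c 0%N) * expR (A * q ^+ i).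
Hypothesis c_xi : forall k, psum_lim c (xi k)%:C = 0.
Hypothesis xi_all : forall w, psum_lim c w = 0 -> exists k, w = (xi k)%:C.
(** Simplicity as indivisibility by a squared factor, the form that dividing twice by the same root
    contradicts. *)
Hypothesis c_simple : forall k d, entire_coef d -> c <> mulroot (xi k)%:C (mulroot (xi k)%:C d).

(** Counting the roots up to [2 ^ i] uses the majorant at [4 * 2 ^ i], whence [q ^ 2]; [ln 3] comes
    from [count_roots]. [K] is the resulting constant of [dyadic_sum]. *)
Let A1 := A * q ^+ 2 / ln 3.
Let K := A1 * q / (1 - q / 2).

Let l3 : 0 < ln 3 :> R.
Proof. by rewrite ln_gt0// ltr1n. Qed.

Let q0 : 0 < q.
Proof. by rewrite (lt_le_trans ltr01). Qed.

Let A10 : 0 <= A1.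
Proof. by rewrite /A1 divr_ge0 ?mulr_ge0 ?exprn_ge0// ltW. Qed.

Lemma hadamard_const_ge0 : 0 <= K.
Proof.
rewrite /K divr_ge0//; first by rewrite mulr_ge0// ltW.
by rewrite subr_ge0 ler_pdivrMr// mul1r ltW.
Qed.

Let pow4 i : 4 * 2 ^+ i = 2 ^+ i.+2 :> R.
Proof. by rewrite !exprS; ring. Qed.

Let A1E i : A * q ^+ i.+2 / ln 3 = A1 * q ^+ i.
Proof. by rewrite /A1 -addn2 exprD; field; rewrite gt_eqF. Qed.

Lemma count_xi i n : (count (fun x => x <= 2 ^+ i) [seq xi k | k <- iota 0 n])%:R <= A1 * q ^+ i.
Proof.
rewrite -A1E (le_trans _ (@count_roots c (quotient c n) (real_roots n) (2 ^+ i) _ _ _ _ _ _ _))//.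
- rewrite /real_roots !count_map ler_nat; apply/eq_leq/eq_count => k /=.
  by rewrite cabs_real gtr0_norm.
- exact: real_roots_neq0.
- exact: entire_quotient.
- by rewrite quotientK.
- by rewrite pow4.
Qed.

Lemma counting_function m : exists n, forall k, (k < n)%N = (xi k <= 2 ^+ m).
Proof.
have xm : {mono xi : i j / (i <= j)%N >-> i <= j} := le_mono xi_incr.
have [k Hk] : exists k, 2 ^+ m < xi k.
  apply: contrapT => /forallNP H.
  have [b Hb] : exists b : nat, A1 * q ^+ m < b%:R.
    exists (Num.bound (A1 * q ^+ m)); apply: archi_boundP.
    by rewrite mulr_ge0 ?exprn_ge0// ltW.
  have := count_xi m b; rewrite count_map (@eq_count _ _ predT) ?count_predT ?size_iota.
    by rewrite leNgt Hb.
  by move=> k /=; apply/negPn/negP; rewrite -ltNge; exact: H.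
have ex : exists k, 2 ^+ m < xi k by exists k.
exists (ex_minn ex); case: ex_minnP => n Hn nmin k'.
apply/idP/idP => [kn|].
  rewrite leNgt; apply/negP => /nmin; by rewrite leqNgt kn.
by rewrite ltnNge; apply: contraL => nk; rewrite -ltNge (lt_le_trans Hn)// xm.
Qed.

Lemma tail_sum m n L : (forall k, (k < n)%N = (xi k <= 2 ^+ m)) ->
  \sum_(n <= k < L) (xi k)^-1 <= K * (q / 2) ^+ m.
Proof.
move=> Hn; rewrite -(big_map xi xpredT (fun x => x^-1)); apply: dyadic_sum => //.
  move=> _ /mapP[k + ->]; rewrite mem_index_iota => /andP[nk _].
  by rewrite ltNge -Hn -leqNgt.
move=> i mi; rewrite (le_trans _ (count_xi i L))// ler_nat !count_map.
have [nL|Ln] := leqP n L; last first.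
  by rewrite /index_iota (_ : L - n = 0)%N//; apply/eqP; rewrite subn_eq0 ltnW.
by rewrite -{2}(subnKC nL) iotaD count_cat leq_addl.
Qed.

(** A zero of the quotient in this disk is a zero of [c], hence one of the [xi k] already divided
    out; it would be a double root of [c]. *)
Lemma quotient_zero_free m n w : (forall k, (k < n)%N = (xi k <= 2 ^+ m)) ->
  cabs w <= 2 ^+ m -> psum_lim (quotient c n) w != 0.
Proof.
move=> Hn wm; apply/eqP => w0.
have /xi_all[k wk] : psum_lim c w = 0 by rewrite (psum_lim_quotient n w ec c_xi) w0 mulr0.
have kn : (k < n)%N by rewrite Hn; move: wm; rewrite wk cabs_real gtr0_norm.
have ed : entire_coef (divroot w (quotient c n)).
  by apply: entire_divroot => //; [rewrite wk xi_neq0|exact: entire_quotient].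
have wn : w \in real_roots n by rewrite wk; apply/mapP; exists k => //; rewrite mem_iota add0n.
have s0 := real_roots_neq0 n.
move: (quotientK c n); move: wn s0 => /path.splitPr[s1 s2]; rewrite mem_cat inE !negb_or => /and3P[s10 _ s20].
rewrite mulroots_cat /= -{1}(mulrootK w (quotient c n)) mulroots_mulroot !mulroots_mulroot => /esym.
rewrite -mulroots_cat wk; apply: c_simple; rewrite -wk; apply: entire_mulroots => //.
by rewrite mem_cat negb_or s10.
Qed.

Lemma quotient_bound m n x M : (forall k, (k < n)%N = (xi k <= 2 ^+ m)) -> 0 <= x ->
  abs_psum (quotient c n) x M <= cabs (c 0%N) * expR (x * (K * (q / 2) ^+ m)).
Proof.
move=> Hn x0; set d := quotient c n; have ed : entire_coef d by exact: entire_quotient.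
have [|N0 HN0] := @psum_zero_free d (2 ^+ m) ed (exprn_gt0 _ (ltr0n _ 2)).
  by move=> w; exact: quotient_zero_free.
(* [N > M] makes the truncation agree with [d] on the first [M] coefficients; [N > N0] keeps its
   roots outside the disk of radius [2 ^ m]. *)
pose N := (maxn N0 M).+1.
have d0 : d 0%N = c 0%N by exact: quotient_coef0.
have [||s [s0 sz sE]] := @truncate_roots d N; rewrite ?d0//.
have big z : z \in s -> 2 ^+ m < cabs z.
  move=> zs; rewrite ltNge; apply/negP => zm.
  have /negP := HN0 N (leq_trans (leq_maxl _ _) (leqnSn _)) z zm; apply.
  by apply/eqP; exact: sz.
pose e0 := fun j : nat => if j is 0%N then c 0%N else 0.
have eae : forall r L, abs_psum e0 r L.+1 = cabs (c 0%N).
  by move=> r L; rewrite /abs_psum big_ord_recl big1 ?expr0 ?mulr1 ?addr0// => j _; rewrite cabs0 mul0r.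
have ee0 : entire_coef e0.
  by move=> r r0; exists (cabs (c 0%N)) => -[|L]; rewrite ?abs_psum0 ?cabs_ge0 ?eae.
have sum_s : \sum_(z <- s) (cabs z)^-1 <= K * (q / 2) ^+ m.
  rewrite -(big_map (@cabs R) xpredT (fun x => x^-1)); apply: dyadic_sum => //.
    by move=> _ /mapP[z zs ->]; exact: big.
  move=> i mi; rewrite -A1E count_map.
  have c0E : truncate d N 0%N = c 0%N by rewrite /truncate.
  apply: (@count_roots (truncate d N) e0) => //; rewrite ?c0E//; first by rewrite sE d0.
  (* The growth of [c] controls the Taylor polynomial: truncation does not raise the majorant, nor
     does division by the first [n] roots, which are at most half the radius [2 ^ i.+2] as
     [i >= m]. *)
  rewrite pow4 (le_trans _ (growth _))//.
  rewrite (@le_trans _ _ (majorant d (2 ^+ i.+2)))//.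
    apply: majorant_le_coef => // j; rewrite /truncate; case: ifP => // _.
    by rewrite cabs0 cabs_ge0.
  rewrite -[X in _ <= majorant X _](quotientK c n); apply: majorant_mulroots_ge1 => //.
    exact: real_roots_neq0.
  move=> z /mapP[k]; rewrite mem_iota add0n => /andP[_ kn] ->.
  rewrite cabs_real gtr0_norm// (@le_trans _ _ (2 * 2 ^+ m))//.
    by rewrite ler_wpM2l// -Hn.
  by rewrite -exprS ler_weXn2l ?ler1n// ltnS ltnW.
have -> : abs_psum d x M = abs_psum (truncate d N) x M.
  apply: eq_bigr => j _; rewrite /truncate ifT// (ltn_trans (ltn_ord j))//.
  by rewrite /N ltnS leq_maxr.
rewrite sE d0 (le_trans (abs_psum_mulroots _ _ s0 x0))// mulrC.
have h : abs_psum e0 x M <= cabs (c 0%N).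
  by case: M {N sz sE big sum_s} => [|M]; rewrite ?abs_psum0 ?cabs_ge0// eae.
rewrite ler_pM ?abs_psum_ge0 ?expR_ge0// ler_expR.
by rewrite ler_wpM2l.
Qed.

End Hadamard.
End Quotients.
End Roots.

(** * Series bounded on the imaginary axis *)

Section Core.
Variable R : realType.
Local Notation C := R[i].

Definition one_coef (j : nat) : C := if j is 0%N then 1 else 0.

(* The [j]-th elementary symmetric polynomial in the [(xi k)^-1], [k < n]. *)
Fixpoint inv_esym (xi : nat -> R) n j : R :=
  if n is k.+1 then
    inv_esym xi k j + (if j is i.+1 then inv_esym xi k i / xi k else 0)
  else (if j is 0%N then 1 else 0).

Definition quotient_coef_vanish (xi : nat -> R) (c : nat -> C) (n : nat -> nat) :=
  forall j, (0 < j)%N -> forall e, 0 < e ->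
  exists M0, forall M, (M0 <= M)%N -> cabs (quotient xi c (n M) j) < e.

Lemma expr_lt_eps (q B e : R) : 0 <= q -> q < 1 -> 0 <= B -> 0 < e ->
  exists M0, forall M, (M0 <= M)%N -> B * q ^+ M < e.
Proof.
move=> q0 q1 B0 e0.
have : (fun M => B * q ^+ M) @ \oo --> (0 : R).
  rewrite -(mulr0 B); apply: cvgM; first exact: cvg_cst.
  by apply: cvg_expr; rewrite ger0_norm.
move=> /cvgrPdist_lt /(_ e e0)[M0 _ H]; exists M0 => M /H /=.
by rewrite sub0r normrN ger0_norm// mulr_ge0// exprn_ge0.
Qed.

Lemma expR_sub1_lt_eps (q B D e : R) : 0 <= q -> q < 1 -> 0 <= B -> 0 <= D -> 0 < e ->
  exists M0, forall M, (M0 <= M)%N -> D * expR (B * q ^+ M) - D < e.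
Proof.
move=> q0 q1 B0 D0 e0.
have : (fun M => D * expR (B * q ^+ M) - D) @ \oo --> (D * expR (B * 0) - D : R).
  apply: cvgB; last exact: cvg_cst.
  apply: cvgM; first exact: cvg_cst.
  apply: (continuous_cvg _ (@continuous_expR R _)).
  apply: cvgM; first exact: cvg_cst.
  by apply: cvg_expr; rewrite ger0_norm.
rewrite mulr0 expR0 mulr1 subrr.
move=> /cvgrPdist_lt /(_ e e0)[M0 _ H]; exists M0 => M /H /=.
by rewrite sub0r normrN; apply: le_lt_trans; exact: ler_norm.
Qed.

Section Sequence.
Variable xi : nat -> R.
Hypothesis xi_gt0 : forall k, 0 < xi k.
Hypothesis xi_incr : {homo xi : m n / (m < n)%N >-> m < n}.

Lemma inv_esymP n j :
  mulroots (real_roots xi n) one_coef j = ((-1) ^+ j * inv_esym xi n j)%:C.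
Proof.
elim: n j => [|n IH] j.
  by case: j => [|j] /=; rewrite ?mulr0 ?expr0 ?mulr1.
rewrite real_rootsS mulroots_cat /= mulroots_mulroot.
case: j => [|j] /=; first by rewrite IH addr0.
rewrite !IH -rmorphV ?unitfE ?gt_eqF//= -rmorphM -rmorphB /=.
by congr (_%:C); rewrite exprS; ring.
Qed.

Lemma inv_esym_ge0 n j : 0 <= inv_esym xi n j.
Proof.
elim: n j => [|n IH] [|j] //=; rewrite ?addr0//.
by rewrite addr_ge0// divr_ge0// ltW.
Qed.

Lemma inv_esym_le n n' j : (n <= n')%N -> inv_esym xi n j <= inv_esym xi n' j.
Proof.
move=> /subnK <-; elim: (n' - n)%N => // k IH; rewrite addSn /=.
rewrite (le_trans IH)// lerDl; case: j {IH} => // j.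
by rewrite divr_ge0 ?inv_esym_ge0// ltW.
Qed.

Lemma inv_esym_gt0 n j : (j <= n)%N -> 0 < inv_esym xi n j.
Proof.
elim: n j => [|n IH] [|j] //= jn; first by rewrite addr0 IH.
by rewrite ltr_wpDl ?inv_esym_ge0// divr_gt0// IH.
Qed.

Lemma mulroots_sub s (c d : nat -> C) a j :
  mulroots s (fun i => c i - a * d i) j = mulroots s c j - a * mulroots s d j.
Proof.
elim: s j => //= z s IH [|j] /=; rewrite !IH//; ring.
Qed.

Variables (n : nat -> nat) (K q : R).
Hypothesis K0 : 0 <= K.
Hypothesis q1 : 1 <= q.
Hypothesis q2 : q < 2.
Hypothesis nP : forall m k, (k < n m)%N = (xi k <= 2 ^+ m).
Hypothesis tail : forall m L, \sum_(n m <= k < L) (xi k)^-1 <= K * (q / 2) ^+ m.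

Let qh0 : 0 <= q / 2.
Proof. by rewrite divr_ge0// (le_trans ler01). Qed.

Let qh1 : q / 2 < 1.
Proof. by rewrite ltr_pdivrMr// mul1r. Qed.

Lemma sum_xi_bounded : exists S, forall L, \sum_(k < L) (xi k)^-1 <= S.
Proof.
exists (\sum_(k < n 0) (xi k)^-1 + K) => L.
rewrite -(big_mkord xpredT (fun k => (xi k)^-1)).
have [Ln|nL] := leqP L (n 0%N).
  rewrite ler_wpDr// -(big_mkord xpredT (fun k => (xi k)^-1)) [leRHS](big_cat_nat (leq0n L) Ln)//=.
  by rewrite lerDl sumr_ge0// => k _; rewrite invr_ge0 ltW.
rewrite (big_cat_nat (n := n 0%N))//=; last exact: ltnW.
by rewrite big_mkord lerD2l (le_trans (tail _ _))// expr0 mulr1.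
Qed.

(** Replacing the quotient by its constant term changes its first coefficients little, and
    multiplying back by the finite product costs at most [expR S], uniformly in [M]. *)
Lemma coef_approx (c : nat -> C) : quotient_coef_vanish xi c n ->
  forall j e, 0 < e -> exists M0, forall M, (M0 <= M)%N ->
  cabs (c j - c 0%N * mulroots (real_roots xi (n M)) one_coef j) < e.
Proof.
move=> V j e e0; have [S HS] := sum_xi_bounded.
have e'0 : 0 < e / expR S / j.+1%:R by rewrite !divr_gt0 ?expR_gt0.
have [M0 HM0] : exists M0, forall M, (M0 <= M)%N ->
    abs_psum (fun i => quotient xi c (n M) i - c 0%N * one_coef i) 1 j.+1 < e / expR S.
  have /choice[f Hf] : forall i, exists M0, forall M, (M0 <= M)%N ->
     cabs (quotient xi c (n M) i - c 0%N * one_coef i) < e / expR S / j.+1%:R.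
    case=> [|i]; first by exists 0%N => M _ /=; rewrite quotient_coef0 mulr1 subrr cabs0.
    have [M0 HM0] := V i.+1 isT _ e'0.
    by exists M0 => M MM /=; rewrite mulr0 subr0 HM0.
  exists (\max_(i < j.+1) f i)%N => M MM.
  rewrite /abs_psum [ltRHS](_ : _ = \sum_(i < j.+1) e / expR S / j.+1%:R); last first.
    by rewrite sumr_const card_ord -[RHS]mulr_natr divfK// pnatr_eq0.
  rewrite ltr_sum//; first by apply/hasP; exists ord0; rewrite ?mem_index_enum.
  move=> i _; rewrite expr1n mulr1; apply: Hf; rewrite (leq_trans _ MM)//.
  by rewrite leq_bigmax_cond.
exists M0 => M MM.
rewrite -[X in X j - _](quotientK xi c (n M)) -mulroots_sub.
set d := fun i => _ - _.
have := abs_psum_mulroots d j.+1 (real_roots_neq0 xi_gt0 (n M)) ler01.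
rewrite [leLHS]abs_psumS expr1n mulr1 mul1r sum_inv_roots// => H.
apply: (@le_lt_trans _ _ (expR S * abs_psum d 1 j.+1)); last first.
  by rewrite mulrC -ltr_pdivlMr ?expR_gt0//; apply: HM0.
apply: (@le_trans _ _ (expR (\sum_(k < n M) (xi k)^-1) * abs_psum d 1 j.+1)).
  by apply: le_trans H; rewrite lerDr abs_psum_ge0.
by rewrite ler_wpM2r ?abs_psum_ge0// ler_expR.
Qed.

Lemma n_unbounded j : exists M0, forall M, (M0 <= M)%N -> (j <= n M)%N.
Proof.
have [M0 H] := exists_expr_gt (xi j); exists M0 => M MM; apply: ltnW.
by rewrite nP (le_trans (ltW H))// ler_weXn2l// ler1n.
Qed.

(** At radius 1 the constant coefficient already takes up [cabs (c 0)], leaving the others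
    [cabs (c 0) * (expR _ - 1)], which tends to 0. *)
Lemma quotient_vanish (c : nat -> C) :
  (forall m x M, 0 <= x -> abs_psum (quotient xi c (n m)) x M
     <= cabs (c 0%N) * expR (x * (K * (q / 2) ^+ m))) ->
  quotient_coef_vanish xi c n.
Proof.
move=> H [//|j] _ e e0.
have [M0 HM0] := expR_sub1_lt_eps qh0 qh1 K0 (cabs_ge0 (c 0%N)) e0.
exists M0 => M MM; apply: le_lt_trans (HM0 M MM).
have h1 := H M 1 j.+2 ler01; rewrite abs_psumS expr1n mulr1 mul1r in h1.
have h2 : cabs (c 0%N) <= abs_psum (quotient xi c (n M)) 1 j.+1.
  rewrite /abs_psum big_ord_recl expr0 mulr1 quotient_coef0 lerDl sumr_ge0//.
  by move=> i _; rewrite abs_psum_term_ge0.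
by rewrite lerBrDr (le_trans _ h1)// addrC lerD2r.
Qed.

Lemma quotient_mulroots c k l :
  quotient xi c k = mulroots [seq (xi i)%:C | i <- iota k l] (quotient xi c (k + l)).
Proof.
elim: l k => [|l IH] k; first by rewrite addn0.
by rewrite /= -addSnnS -IH /= mulrootK.
Qed.

Section Imaginary.
Variables (h : nat -> C) (Y0 Y1 A : R).
Hypothesis eh : entire_coef h.
Hypothesis A0 : 0 <= A.
Hypothesis Y00 : 0 <= Y0.
Hypothesis Y10 : 0 <= Y1.
Hypothesis hgrowth : forall i, majorant h (2 ^+ i) <= Y0 * expR (A * q ^+ i).
Hypothesis h_xi : forall k, psum_lim h (xi k)%:C = 0.
(** A finite substitute for domination by the product over all [xi k]: the length [L] may depend on
    [m], and the exponential, whose rate vanishes as [m] grows, pays for the truncation. *)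
Hypothesis h_imag : forall m, exists L, forall x : R,
  cabs (psum_lim h (x%:C * 'i%C)) <=
  Y1 * expR (`|x| * (K * (q / 2) ^+ m)) * \prod_(k < L) cabs (1 - x%:C * 'i%C / (xi k)%:C).

Lemma cabs_imag_sqr (x y : R) : cabs (1 - x%:C * 'i%C / y%:C) ^+ 2 = 1 + (x / y) ^+ 2.
Proof.
have -> : 1 - x%:C * 'i%C / y%:C = 1 +i* - (x / y).
  rewrite mulrAC -fmorphV -rmorphM; apply/eqP; rewrite eq_complex /=.
  by apply/andP; split; apply/eqP; ring.
by rewrite cabs_sqr /= expr1n sqrrN.
Qed.

Lemma cabs_imag_ge1 (x y : R) : 1 <= cabs (1 - x%:C * 'i%C / y%:C).
Proof.
rewrite -(ler_pXn2r (n := 2))// ?nnegrE ?cabs_ge0// expr1n cabs_imag_sqr.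
by rewrite lerDl sqr_ge0.
Qed.

Lemma cabs_imag_le_exp (x y : R) : 0 < y -> cabs (1 - x%:C * 'i%C / y%:C) <= expR (`|x| / y).
Proof.
move=> y0; rewrite (le_trans (cabsB _ _))// cabs1 !cabsM cabs_i mulr1 cabsV !cabs_real.
by rewrite (gtr0_norm y0) expR_ge1Dx.
Qed.

(** The factors with [k < n M] cancel; those from [n M] to [L] cost at most the exponential of
    [h_imag] once more, hence the 2. *)
Lemma quotient_imag_bound M (x : R) :
  cabs (psum_lim (quotient xi h (n M)) (x%:C * 'i%C)) <=
  Y1 * expR (2 * (`|x| * (K * (q / 2) ^+ M))).
Proof.
have [L HL] := h_imag M; have := HL x.
rewrite (psum_lim_quotient xi_gt0 xi_incr (n M) _ eh h_xi) cabsM.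
pose F k := cabs (1 - x%:C * 'i%C / (xi k)%:C).
have F1 k : 1 <= F k by exact: cabs_imag_ge1.
have F0 k : 0 < F k by rewrite (lt_le_trans ltr01).
have -> : cabs (\prod_(z <- real_roots xi (n M)) (1 - x%:C * 'i%C / z)) = \prod_(0 <= k < n M) F k.
  rewrite big_map /index_iota subn0; elim: (iota _ _) => [|k s IH]; first by rewrite !big_nil cabs1.
  by rewrite !big_cons cabsM IH.
rewrite -(big_mkord xpredT F); set E := expR _; set P := \prod_(_ <= _ < n M) _.
have P0 : 0 < P by rewrite prodr_gt0.
have E1 : 1 <= E.
  by rewrite -[leLHS]expR0 ler_expR mulr_ge0// mulr_ge0// exprn_ge0.
have G1 a b : 1 <= \prod_(a <= k < b) F k.
  by elim/big_ind: _ => // y z; exact: mulr_ege1.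
have HP : \prod_(0 <= k < L) F k <= P * E.
  have [Ln|nL] := leqP L (n M).
    rewrite /P [X in _ <= X * _](big_cat_nat (leq0n L) Ln)//= -mulrA ler_peMr//.
      by rewrite (le_trans ler01).
    by rewrite mulr_ege1.
  rewrite (big_cat_nat (n := n M))//=; last exact: ltnW.
  rewrite ler_pM2l// (@le_trans _ _ (\prod_(n M <= k < L) expR (`|x| / xi k)))//.
    by apply: ler_prod => k _; rewrite (ltW (F0 k)) cabs_imag_le_exp.
  rewrite -expR_sum ler_expR -mulr_sumr ler_wpM2l//.
move=> H.
rewrite -(ler_pM2l P0) (le_trans H)//.
rewrite mulr2n mulrDl mul1r expRD -/E.
rewrite (_ : P * _ = (Y1 * E) * (P * E)); last by ring.
by rewrite ler_wpM2l// mulr_ge0// ltW// (lt_le_trans ltr01).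
Qed.

Let B := 4 * K + 8 * A.

(** The bound is uniform in [M]. Division by the roots up to [2 ^ m.+2] does not raise the majorant
    at [2 ^ m.+3]; the further roots are at least twice the radius [2 ^ m.+1], and dividing by them
    costs an exponential of their inverse sum. The 4 and 8 in [B] bound [q ^ 2] and [q ^ 3]. *)
Lemma quotient_majorant m M : (m.+2 <= M)%N ->
  majorant (quotient xi h (n M)) (2 * 2 ^+ m) <= Y0 * expR (B * q ^+ m).
Proof.
move=> mM; have ek l := entire_quotient xi_gt0 xi_incr l eh h_xi.
have q0 : 0 <= q by rewrite (le_trans ler01).
have nn : (n m.+2 <= n M)%N.
  rewrite leqNgt; apply/negP; rewrite nP => h1; have := ltnn (n M); rewrite [X in _ = X -> _]/=.
  by rewrite nP (le_trans h1)// ler_weXn2l// ler1n.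
have e0 : 0 <= 2 * 2 ^+ m :> R by rewrite mulr_ge0// exprn_ge0.
apply: majorant_le => N; pose s := [seq (xi i)%:C | i <- iota (n m.+2) (n M - n m.+2)].
have s0 : 0 \notin s.
  by apply/negP => /mapP[i _ /eqP]; rewrite eq_sym (negbTE (xi_neq0 xi_gt0 i)).
have sbig : {in s, forall z, 2 * (2 * 2 ^+ m) <= cabs z}.
  move=> _ /mapP[i + ->]; rewrite mem_iota => /andP[ni _].
  by rewrite cabs_real gtr0_norm// -!exprS ltW// ltNge -nP -leqNgt.
have ssum : \sum_(z <- s) (cabs z)^-1 <= K * (q / 2) ^+ m.+2.
  rewrite big_map (le_trans _ (tail m.+2 (n M)))// le_eqVlt; apply/orP; left; apply/eqP.
  by apply: eq_bigr => i _; rewrite cabs_real gtr0_norm.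
have := abs_psum_mulroots_ge (quotient xi h (n M)) N s0 e0 sbig.
rewrite -(_ : quotient xi h (n m.+2) = mulroots s (quotient xi h (n M))); last first.
  by rewrite (quotient_mulroots h (n m.+2) (n M - n m.+2)) subnKC.
have h3 : abs_psum (quotient xi h (n m.+2)) (2 * 2 ^+ m) N <= Y0 * expR (A * q ^+ m.+3).
  rewrite (le_trans (abs_psum_le_majorant N (ek _) e0))//.
  rewrite (le_trans _ (hgrowth m.+3))//.
  rewrite (@le_trans _ _ (majorant (quotient xi h (n m.+2)) (2 ^+ m.+3)))//.
    by rewrite majorant_ler// -exprS ler_weXn2l ?ler1n// -addn3 -addn1 leq_add2l.
  rewrite -[X in _ <= majorant X _](quotientK xi h (n m.+2)); apply: majorant_mulroots_ge1 => //.
    exact: real_roots_neq0.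
  move=> z /mapP[k]; rewrite mem_iota add0n => /andP[_ kn] ->.
  by rewrite cabs_real gtr0_norm// exprS ler_wpM2l// -nP.
move=> /le_trans; apply.
rewrite (@le_trans _ _ (expR (2 * (2 * 2 ^+ m) * (K * (q / 2) ^+ m.+2)) * (Y0 * expR (A * q ^+ m.+3))))//.
  by rewrite ler_pM ?expR_ge0 ?abs_psum_ge0// ler_expR ler_wpM2l//.
rewrite mulrCA -expRD ler_wpM2l// ler_expR.
have -> : 2 * (2 * 2 ^+ m) * (K * (q / 2) ^+ m.+2) = K * q ^+ 2 * q ^+ m.
  rewrite [(q / 2) ^+ _]exprS [(q / 2) ^+ _]exprS expr_div_n; field.
  by rewrite expf_neq0// pnatr_eq0.
have -> : A * q ^+ m.+3 = A * q ^+ 3 * q ^+ m by rewrite -[m.+3]/(3 + m)%N exprD mulrA.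
rewrite -mulrDl ler_wpM2r ?exprn_ge0// /B lerD// mulrC ler_wpM2r//.
  have : q ^+ 2 <= 2 ^+ 2 by rewrite lerXn2r// ?nnegrE// ltW.
  by rewrite -natrX.
have : q ^+ 3 <= 2 ^+ 3 by rewrite lerXn2r// ?nnegrE// ltW.
by rewrite -natrX.
Qed.

(* The quotient is approximated by its Taylor polynomial of degree [N = O(q ^ m)], which is bounded
   on a segment of length of order [2 ^ m]; Bernstein--Walsh bounds it on fixed disks since
   [N / 2 ^ m] tends to [0]. *)
Lemma quotient_vanish_of_imag : quotient_coef_vanish xi h n.
Proof.
move=> j j0 e e0.
have q0 : 0 <= q by rewrite (le_trans ler01).
have B0 : 0 <= B by rewrite /B addr_ge0// mulr_ge0.
have ek l := entire_quotient xi_gt0 xi_incr l eh h_xi.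
(* Bound on the segment: [Y1 * expR 1] for the quotient and 1 for the truncation error. *)
pose B1 := Y1 * expR 1 + 1.
have B10 : 0 < B1 by rewrite ltr_wpDl// mulr_ge0// expR_ge0.
(* Chosen so that Cauchy's bound on the circle of radius [r >= 1] gives [B1 * expR 1 / r < e] for
   the [j]-th coefficient. *)
pose r := 1 + B1 * expR 1 / e.
have l2 : 0 < ln 2 :> R by rewrite ln_gt0// ltr1n.
have [N2 HN2] := exists_expr_gt Y0.
have r0 : 0 < r by rewrite ltr_pwDl// divr_ge0 ?mulr_ge0 ?expR_ge0 ?(ltW B10)// ltW.
have e4 : 0 < (4 * r)^-1 by rewrite invr_gt0 mulr_gt0.
have [m0 Hm0] := expr_lt_eps qh0 qh1 (divr_ge0 B0 (ltW l2)) e4.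
have h20 : 0 <= (2^-1 : R) by [].
have h21 : (2^-1 : R) < 1 by rewrite invf_lt1// ltr1n.
have [m1 Hm1] := expr_lt_eps h20 h21 (ler0n R (1 + N2 + j)) e4.
pose m := maxn m0 m1.
have p2 : 0 < 2 ^+ m :> R by rewrite exprn_gt0.
have Bq0 : 0 <= B * q ^+ m / ln 2 by rewrite divr_ge0 ?(ltW l2)// mulr_ge0// exprn_ge0.
(* [2 ^ N1] exceeds [expR (B * q ^ m)] and [2 ^ N2] exceeds [Y0], so the truncation error is at most
   1; the summand [j] in [N] below keeps the [j]-th coefficient. *)
pose N1 := (Num.truncn (B * q ^+ m / ln 2)).+1.
have /andP[N1le HN1] := truncn_itv Bq0; rewrite -/N1 in HN1.
have HN1' : N1%:R <= B * q ^+ m / ln 2 + 1 by rewrite /N1 -natr1 lerD2r.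
pose N := (N1 + N2 + j)%N.
(* This keeps the Bernstein--Walsh factor [(1 + 2 * r / 2 ^ m) ^ N] below [expR 1]. *)
have Nsmall : 2 * r * (N%:R / 2 ^+ m) <= 1.
  have a1 : B / ln 2 * (q / 2) ^+ m < (4 * r)^-1 by apply: Hm0; rewrite leq_maxl.
  have a2 : (1 + N2 + j)%:R * (2^-1) ^+ m < (4 * r)^-1 by apply: Hm1; rewrite leq_maxr.
  have : N%:R / 2 ^+ m <= (4 * r)^-1 + (4 * r)^-1.
    rewrite (le_trans _ (lerD (ltW a1) (ltW a2)))//.
    rewrite expr_div_n exprVn [X in _ <= X + _]mulrA -mulrDl ler_wpM2r ?invr_ge0 ?exprn_ge0//.
    rewrite /N -addnA natrD (le_trans (lerD HN1' (lexx _)))//.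
    by rewrite -addnA [X in _ <= _ + X]natrD addrA mulrAC.
  rewrite -(ler_pM2l (_ : 0 < 2 * r)) ?mulr_gt0// => /le_trans; apply.
  rewrite le_eqVlt; apply/orP; left; apply/eqP; field.
  by rewrite gt_eqF.
have EN : Y0 * expR (B * q ^+ m) / 2 ^+ N.+1 <= 1.
  rewrite ler_pdivrMr ?exprn_gt0// mul1r.
  apply: (@le_trans _ _ (2 ^+ N2 * 2 ^+ N1)).
    rewrite ler_pM ?expR_ge0 ?(ltW HN2)//.
    rewrite -[leRHS]lnK ?posrE ?exprn_gt0// ler_expR lnXn// -[leRHS]mulr_natl.
    by rewrite -ler_pdivrMr// ltW.
  by rewrite -exprD ler_weXn2l ?ler1n// (addnC N2) leqW// leq_addr.
have K2 : 0 <= 2 * (2 ^+ m * K) by rewrite mulr_ge0// mulr_ge0// ltW.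
(* With [m] now fixed, large [M] make the exponent in [quotient_imag_bound] at most 1 on the whole
   segment. *)
have [M1 HM1] := expr_lt_eps qh0 qh1 K2 (ltr01 : 0 < 1 :> R).
exists (maxn m.+2 M1) => M; rewrite geq_max => /andP[mM M1M].
set d := quotient xi h (n M).
have bnd (x : R) : `|x| <= 2 ^+ m -> cabs (psum d (x%:C * 'i%C) N.+1) <= B1.
  move=> xm; rewrite -[psum _ _ _](subrK (psum_lim d (x%:C * 'i%C))) addrC.
  rewrite (le_trans (cabsD _ _))// /B1 lerD//.
    rewrite (le_trans (quotient_imag_bound _ _))// ler_wpM2l// ler_expR.
    rewrite (le_trans _ (ltW (HM1 M M1M)))// -!mulrA !ler_wpM2l//.
    by rewrite ler_wpM2r// mulr_ge0// exprn_ge0.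
  rewrite cabsC (le_trans _ EN)//.
  have xm' : cabs (x%:C * 'i%C) <= 2 ^+ m by rewrite cabsM cabs_i mulr1 cabs_real.
  have := psum_lim_tail N.+1 (ek (n M)) xm' (_ : 1 <= 2); rewrite ler1n => /(_ isT).
  move/le_trans; apply; rewrite ler_wpM2r ?invr_ge0 ?exprn_ge0//.
  exact: quotient_majorant.
have circ w : cabs w = r -> cabs (psum d w N.+1) <= B1 * expR 1.
  move=> wr; rewrite (le_trans (bernstein_walsh_imaginary w p2 bnd))// ler_wpM2l ?(ltW B10)//.
  rewrite wr (@le_trans _ _ (expR (2 * r / 2 ^+ m) ^+ N))//.
    by rewrite lerXn2r ?nnegrE ?expR_ge0 ?expR_ge1Dx// addr_ge0// divr_ge0 ?mulr_ge0 ?(ltW r0) ?(ltW p2).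
  rewrite -expRM_natl ler_expR (le_trans _ Nsmall)// le_eqVlt; apply/orP; left; apply/eqP; ring.
have := cauchy_coef (ltW r0) circ (_ : (j < N.+1)%N).
rewrite ltnS leq_addl => /(_ isT) H.
have rj : r <= r ^+ j.
  by rewrite -[leLHS]expr1 ler_weXn2l// lerDl divr_ge0 ?mulr_ge0 ?expR_ge0 ?(ltW B10)// ltW.
have : cabs (d j) * r <= B1 * expR 1 by rewrite (le_trans _ H)// ler_wpM2l ?cabs_ge0.
rewrite -ler_pdivlMr// => /le_lt_trans; apply.
by rewrite ltr_pdivrMr// /r mulrDr mulr1 mulrCA divff ?gt_eqF// mulr1 ltrDr.
Qed.

End Imaginary.
End Sequence.
End Core.

(** * Vanishing of the moments *)

Section Moments.
Variable R : realType.
Local Notation C := R[i].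

Definition alt_coef (a : nat -> R) (j : nat) : C := ((-1) ^+ j * a j)%:C.

(* [soz_growth] with [q < 2] expresses order less than one along the radii [2 ^ i]. *)
Record small_order_zeros (c : nat -> C) (xi : nat -> R) (A q : R) : Prop := {
  soz_gt0 : forall k, 0 < xi k;
  soz_incr : {homo xi : m n / (m < n)%N >-> m < n};
  soz_entire : entire_coef c;
  soz_coef0 : c 0%N != 0;
  soz_growth : forall i, majorant c (2 ^+ i) <= cabs (c 0%N) * expR (A * q ^+ i);
  soz_root : forall k, psum_lim c (xi k)%:C = 0;
  soz_all : forall w, psum_lim c w = 0 -> exists k, w = (xi k)%:C;
  soz_simple : forall k d, entire_coef d -> c <> mulroot (xi k)%:C (mulroot (xi k)%:C d) }.

(** The elementary symmetric sums increase with the number of roots and are positive from [j] roots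
    on; by [coef_approx] their limit is [a j / a 0]. *)
Lemma alt_coef_gt0 (a xi : nat -> R) (n : nat -> nat) (K q : R) :
  (forall k, 0 < xi k) -> 0 <= K ->
  (forall m k, (k < n m)%N = (xi k <= 2 ^+ m)) ->
  (forall m L, \sum_(n m <= k < L) (xi k)^-1 <= K * (q / 2) ^+ m) ->
  quotient_coef_vanish xi (alt_coef a) n -> 0 < a 0%N -> forall j, 0 < a j.
Proof.
move=> x0 K0 nP tail V a0 j.
have E0 := inv_esym_gt0 x0 (leqnn j); set e := inv_esym xi j j in E0.
have ae : 0 < a 0%N * e by rewrite mulr_gt0.
have [M0 HM0] := coef_approx x0 K0 tail V j ae.
have [M1 HM1] := n_unbounded nP j.
pose M := maxn M0 M1; have := HM0 M (leq_maxl _ _).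
rewrite inv_esymP// /alt_coef expr0 mul1r -rmorphM -rmorphB cabs_real /=.
rewrite (_ : _ - _ = (-1) ^+ j * (a j - a 0%N * inv_esym xi (n M) j)); last by ring.
rewrite normrM normrX normrN1 expr1n mul1r => H.
have eM : e <= inv_esym xi (n M) j by apply: inv_esym_le => //; apply: HM1; rewrite leq_maxr.
have : a 0%N * e <= a 0%N * inv_esym xi (n M) j by rewrite ler_wpM2l// ltW.
move: H; rewrite ltr_norml => /andP[H _]; lra.
Qed.

Variables (mo : nat -> R) (Y : R).
Hypothesis Y0 : 0 <= Y.
(** [mo] stands for the moments in [t = x ^ 2]: the values at [t ^ j] of a real functional on
    polynomials, of norm at most [Y] for the supremum on [0, 1]. *)
Hypothesis moP : forall (d : nat -> R) N B,
  (forall t, 0 <= t -> t <= 1 -> `|\sum_(j < N) d j * t ^+ j| <= B) ->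
  `|\sum_(j < N) d j * mo j| <= Y * B.

Lemma moment_le j : `|mo j| <= Y.
Proof.
have := @moP (fun i => (i == j)%:R) j.+1 1.
have E (u : nat -> R) : \sum_(i < j.+1) (val i == j)%:R * u i = u j.
  rewrite (bigD1 ord_max)//= eqxx mul1r big1 ?addr0// => i.
  by rewrite -val_eqE /= => /negbTE ->; rewrite mul0r.
rewrite (E mo) mulr1; apply => t t0 t1; rewrite (E (fun i => t ^+ i)).
by rewrite ger0_norm ?exprn_ge0// exprn_ile1.
Qed.

Definition moment_coef (c : nat -> C) j : C := c j * (mo j)%:C.

Lemma moment_coef_le c j : cabs (moment_coef c j) <= cabs (Y%:C * c j).
Proof.
rewrite !cabsM mulrC ler_wpM2r ?cabs_ge0// !cabs_real (le_trans (moment_le j))//.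
exact: ler_norm.
Qed.

Lemma entire_scale (u : C) c : entire_coef c -> entire_coef (fun j => u * c j).
Proof.
move=> ec r r0; have [B HB] := ec r r0; exists (cabs u * B) => N.
rewrite (_ : abs_psum _ _ _ = cabs u * abs_psum c r N) ?ler_wpM2l ?cabs_ge0//.
by rewrite /abs_psum mulr_sumr; apply: eq_bigr => i _; rewrite cabsM mulrA.
Qed.

Lemma entire_moment c : entire_coef c -> entire_coef (moment_coef c).
Proof.
by move=> ec; apply: entire_coef_le (entire_scale Y%:C ec) => j; exact: moment_coef_le.
Qed.

Lemma majorant_moment c r : entire_coef c -> 0 <= r ->
  majorant (moment_coef c) r <= Y * majorant c r.
Proof.
move=> ec r0; apply: majorant_le => N.
rewrite (@le_trans _ _ (Y * abs_psum c r N))//; last by rewrite ler_wpM2l// abs_psum_le_majorant.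
rewrite /abs_psum mulr_sumr ler_sum// => j _; rewrite mulrA ler_wpM2r ?exprn_ge0//.
by rewrite cabsM mulrC ler_wpM2r ?cabs_ge0// cabs_real moment_le.
Qed.

(** [moP] is real, so it is applied to the real and imaginary parts of the Taylor polynomials
    separately; adding them costs the factor 2. *)
Lemma moment_sum_bound c w B : entire_coef c ->
  (forall t, 0 <= t -> t <= 1 -> cabs (psum_lim c (w * t%:C)) <= B) ->
  cabs (psum_lim (moment_coef c) w) <= 2 * Y * B.
Proof.
move=> ec HB; have em := entire_moment ec.
have B0 : 0 <= B by rewrite (le_trans (cabs_ge0 _) (HB 0 _ _)).
apply/ler_addgt0Pr => e e0.
set D := majorant c (2 * cabs w).
have D0 : 0 <= D by rewrite majorant_ge0// mulr_ge0 ?cabs_ge0.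
have e2 : 0 < e / 2 by rewrite divr_gt0.
have [N0 HN0] := psum_limP w em e2.
have h20 : 0 <= (2^-1 : R) by [].
have h21 : (2^-1 : R) < 1 by rewrite invf_lt1// ltr1n.
have YD : 0 <= 2 * Y * D by rewrite !mulr_ge0.
have [N1 HN1] := expr_lt_eps h20 h21 YD e2.
pose N := maxn N0 N1.
have part (p : {additive C -> R}) : (forall z (x : R), p (z * x%:C) = p z * x) ->
    (forall z, `|p z| <= cabs z) -> `|p (psum (moment_coef c) w N)| <= Y * (B + D / 2 ^+ N).
  move=> pM ple; rewrite (_ : p _ = \sum_(j < N) p (c j * w ^+ j) * mo j); last first.
    rewrite /psum raddf_sum; apply: eq_bigr => j _.
    by rewrite /moment_coef -mulrA [_%:C * _]mulrC mulrA pM.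
  apply: (moP (d := fun j => p (c j * w ^+ j))) => t t0 t1.
  rewrite (_ : \sum_(j < N) _ = p (psum c (w * t%:C) N)); last first.
    rewrite /psum raddf_sum; apply: eq_bigr => j _.
    by rewrite exprMn mulrA -rmorphXn /= pM.
  rewrite (le_trans (ple _))// -[psum _ _ _](subrK (psum_lim c (w * t%:C))) addrC.
  rewrite (le_trans (cabsD _ _))// lerD ?HB// cabsC.
  have wt : cabs (w * t%:C) <= cabs w.
    by rewrite cabsM cabs_real ger0_norm// ler_piMr ?cabs_ge0.
  by have := psum_lim_tail N ec wt (_ : 1 <= 2); rewrite ler1n => /(_ isT).
rewrite -[psum_lim _ w](subrK (psum (moment_coef c) w N)) (le_trans (cabsD _ _))//.
rewrite addrC [e]splitr addrA lerD ?(ltW (HN0 _ _)) ?leq_maxl//.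
rewrite (le_trans (cabs_le_ReIm _))//.
have hR : `|complex.Re (psum (moment_coef c) w N)| <= Y * (B + D / 2 ^+ N).
  by apply: (part (@complex.Re R)) => [[x y] t|z] /=; rewrite ?mulr0 ?subr0//; exact: Re_le_cabs.
have hI : `|complex.Im (psum (moment_coef c) w N)| <= Y * (B + D / 2 ^+ N).
  by apply: (part (@complex.Im R)) => [[x y] t|z] /=; rewrite ?mulr0 ?add0r//; exact: Im_le_cabs.
rewrite (le_trans (lerD hR hI))//.
have := HN1 N (leq_maxr _ _); rewrite exprVn => h.
rewrite (_ : _ + _ = 2 * Y * B + 2 * Y * D / 2 ^+ N); last by ring.
by rewrite lerD2l ltW.
Qed.

Variables (a b xf xg : nat -> R) (A q : R).
Hypothesis A0 : 0 <= A.
Hypothesis q1 : 1 <= q.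
Hypothesis q2 : q < 2.
Hypothesis a0 : 0 < a 0%N.
Hypothesis b0 : 0 < b 0%N.
Hypothesis fP : small_order_zeros (alt_coef a) xf A q.
Hypothesis gP : small_order_zeros (alt_coef b) xg A q.
Hypothesis xgf : forall k, xg k <= xf k.
Hypothesis ab0 : (fun n => a n / b n) @ \oo --> (0 : R).
Hypothesis mo_root : forall k, psum_lim (moment_coef (alt_coef a)) (xg k)%:C = 0.

Lemma moments_eq0 j : mo j = 0.
Proof.
case: fP => xf0 xfi ef f0 fgr fr fa fs; case: gP => xg0 xgi eg g0 ggr gr ga gs.
set cf := alt_coef a in ef f0 fgr fr fa fs *.
set cg := alt_coef b in eg g0 ggr gr ga gs *.
have /choice[nf nfP] := counting_function xf0 xfi ef f0 A0 q1 fgr fr.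
have /choice[ng ngP] := counting_function xg0 xgi eg g0 A0 q1 ggr gr.
pose K := A * q ^+ 2 / ln 3 * q / (1 - q / 2).
have K0 : 0 <= K := hadamard_const_ge0 A0 q1 q2.
have tf m L : \sum_(nf m <= k < L) (xf k)^-1 <= K * (q / 2) ^+ m.
  exact: (tail_sum xf0 xfi ef f0 A0 q1 q2 fgr fr).
have tg m L : \sum_(ng m <= k < L) (xg k)^-1 <= K * (q / 2) ^+ m.
  exact: (tail_sum xg0 xgi eg g0 A0 q1 q2 ggr gr).
have bf m x M : 0 <= x -> abs_psum (quotient xf cf (nf m)) x M <=
    cabs (cf 0%N) * expR (x * (K * (q / 2) ^+ m)).
  exact: (quotient_bound xf0 xfi ef f0 A0 q1 q2 fgr fr fa fs).
have bg m x M : 0 <= x -> abs_psum (quotient xg cg (ng m)) x M <=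
    cabs (cg 0%N) * expR (x * (K * (q / 2) ^+ m)).
  exact: (quotient_bound xg0 xgi eg g0 A0 q1 q2 ggr gr ga gs).
have Vf := quotient_vanish K0 q1 q2 bf.
have Vg := quotient_vanish K0 q1 q2 bg.
have apos := alt_coef_gt0 xf0 K0 nfP tf Vf a0.
have bpos := alt_coef_gt0 xg0 K0 ngP tg Vg b0.
pose h := moment_coef cf; have eh : entire_coef h := entire_moment ef.
have cf0 : cabs (cf 0%N) = a 0%N by rewrite /cf /alt_coef expr0 mul1r cabs_real gtr0_norm.
have qh0 : 0 <= q / 2 by rewrite divr_ge0// (le_trans ler01).
have hgr i : majorant h (2 ^+ i) <= Y * a 0%N * expR (A * q ^+ i).
  rewrite (le_trans (majorant_moment ef (exprn_ge0 _ _)))// -mulrA ler_wpM2l//.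
  by rewrite -cf0.
have him m : exists L, forall x : R,
    cabs (psum_lim h (x%:C * 'i%C)) <=
    2 * Y * a 0%N * expR (`|x| * (K * (q / 2) ^+ m)) *
    \prod_(k < L) cabs (1 - x%:C * 'i%C / (xg k)%:C).
  (* The quotient by the small roots is bounded by [bf]; as [t <= 1] and [xg k <= xf k], each
     extracted factor at [x * t * i] is at most the factor of [xg k] at [x * i]. *)
  exists (nf m) => x; rewrite -mulrA -[X in _ <= X]mulrA; apply: moment_sum_bound => // t t0 t1.
  rewrite (psum_lim_quotient xf0 xfi (nf m) _ ef fr) cabsM mulrC mulrA.
  rewrite ler_pM ?cabs_ge0//.
    have ent := entire_quotient xf0 xfi (nf m) ef fr.
    have wx : cabs (x%:C * 'i%C * t%:C) <= `|x|.
      rewrite !cabsM cabs_i mulr1 !cabs_real (ger0_norm t0) ler_piMr//.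
    rewrite (le_trans (psum_lim_le ent wx))//; apply: majorant_le => N.
    by rewrite -cf0; apply: bf.
  rewrite big_map -[nf m](subn0) -/(index_iota 0 (nf m)) big_mkord.
  rewrite subn0; elim/big_rec2: _ => [|k y1 y2 _ IH]; first by rewrite cabs1.
  rewrite cabsM ler_pM ?cabs_ge0//.
  rewrite (_ : x%:C * 'i%C * t%:C = (x * t)%:C * 'i%C); last by rewrite rmorphM /=; ring.
  rewrite -(ler_pXn2r (n := 2)) ?nnegrE ?cabs_ge0// !cabs_imag_sqr lerD2l.
  rewrite -mulrA !exprMn ler_wpM2l ?sqr_ge0// -exprMn lerXn2r ?nnegrE ?mulr_ge0 ?invr_ge0
    ?(ltW (xf0 _)) ?(ltW (xg0 _))//.
  rewrite (@le_trans _ _ (xf k)^-1)//; last by rewrite lef_pV2 ?posrE.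
  by rewrite ler_piMl// invr_ge0 ltW.
have Vh : quotient_coef_vanish xg h ng.
  apply: (quotient_vanish_of_imag xg0 xgi K0 q1 q2 ngP tg eh A0 _ _ hgr mo_root him).
    by rewrite mulr_ge0// ltW.
  by rewrite !mulr_ge0// ltW.
(* [h] and [cg] are close to their constant terms times the same product; cross-multiplication
   cancels it. *)
have prop i : h i * cg 0%N = cg i * h 0%N.
  apply/eqP; rewrite -subr_eq0; apply/eqP/cabs_small => e e0.
  pose T := cabs (cg 0%N) + cabs (h 0%N) + 1.
  have T0 : 0 < T by rewrite ltr_wpDl// addr_ge0 ?cabs_ge0.
  have e'0 : 0 < e / T by rewrite divr_gt0.
  have [M0 H0] := coef_approx xg0 K0 tg Vh i e'0.
  have [M1 H1] := coef_approx xg0 K0 tg Vg i e'0.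
  pose M := maxn M0 M1; set p := mulroots (real_roots xg (ng M)) (one_coef R) i.
  have h0 := H0 M (leq_maxl _ _); have h1 := H1 M (leq_maxr _ _).
  rewrite (_ : _ - _ = cg 0%N * (h i - h 0%N * p) - h 0%N * (cg i - cg 0%N * p)); last by ring.
  rewrite (le_lt_trans (cabsB _ _))// (cabsM (cg 0%N)) (cabsM (h 0%N)).
  apply: (@le_lt_trans _ _ (cabs (cg 0%N) * (e / T) + cabs (h 0%N) * (e / T))).
    by apply: lerD; rewrite ler_wpM2l ?cabs_ge0// ltW.
  by rewrite -mulrDl mulrA ltr_pdivrMr// mulrC ltr_pM2l// /T ltrDl.
have propR i : a i * mo i * b 0%N = b i * (a 0%N * mo 0%N).
  have := prop i; rewrite /h /moment_coef /cf /cg /alt_coef -!rmorphM /= => /complexI.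
  rewrite expr0 !mul1r => H; have s : (-1) ^+ i != 0 :> R by rewrite expf_neq0// oppr_eq0 oner_eq0.
  by apply: (mulfI s); move: H; rewrite !mulrA.
have m0 : mo 0%N = 0.
  apply/eqP; apply: contrapT => /negP m0.
  (* Proportionality and [moment_le] would keep [a N / b N] above this [e] for all [N]; [Y + 1] in
     place of [Y] keeps the divisor positive. *)
  pose e := a 0%N * `|mo 0%N| / (b 0%N * (Y + 1)).
  have Yp : 0 < Y + 1 by rewrite ltr_wpDl.
  have mp : 0 < `|mo 0%N| by rewrite normr_gt0.
  have e0 : 0 < e by rewrite divr_gt0 ?mulr_gt0.
  have [N _ HN] := proj1 (cvgrPdist_lt _ _) ab0 e e0.
  have := HN N (leqnn N); rewrite /= sub0r normrN normrM normfV !gtr0_norm//.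
  rewrite ltr_pdivrMr// => HaN.
  have := congr1 Num.norm (propR N); rewrite !normrM.
  rewrite (gtr0_norm (apos N)) (gtr0_norm (bpos N)) (gtr0_norm a0) (gtr0_norm b0) => Hp.
  have : a N * `|mo N| * b 0%N <= a N * Y * b 0%N.
    by rewrite ler_pM2r// ler_pM2l// moment_le.
  rewrite Hp => H3.
  have : a N * (b 0%N * (Y + 1)) < b N * (a 0%N * `|mo 0%N|).
    move: HaN; rewrite /e mulrAC ltr_pdivlMr ?mulr_gt0//.
    by rewrite [X in _ < X -> _]mulrC.
  have : 0 < a N * b 0%N by rewrite mulr_gt0.
  move: H3; rewrite mulrDr; lra.
have := propR j; rewrite m0 !mulr0 => /eqP.
by rewrite !mulf_eq0 (gt_eqF (apos j)) (gt_eqF b0) orbF /= => /eqP.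
Qed.

End Moments.

(** * Even moments determine an integrable function on (0,1) *)

Section Thresholds.
Variable R : realType.

Lemma bernoulli_ge (v : R) N : -1 <= v -> 1 + N%:R * v <= (1 + v) ^+ N.
Proof.
move=> v1; elim: N => [|N IH]; first by rewrite mul0r addr0.
have v10 : 0 <= 1 + v by lra.
rewrite exprS -natr1; have := ler_wpM2l v10 IH.
have : 0 <= N%:R * (v * v) by rewrite mulr_ge0// -expr2 sqr_ge0.
lra.
Qed.

Lemma exprB_le_inv (v : R) N : 0 <= v -> v <= 1 -> (1 - v) ^+ N <= (1 + N%:R * v)^-1.
Proof.
move=> v0 v1; have d0 : 0 < 1 + N%:R * v by rewrite ltr_pwDl// mulr_ge0.
rewrite -[leRHS]mul1r ler_pdivlMr//.
apply: (@le_trans _ _ ((1 - v) ^+ N * (1 + v) ^+ N)).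
  by rewrite ler_wpM2l ?exprn_ge0 ?subr_ge0// bernoulli_ge//; lra.
rewrite -exprMn exprn_ile1//; last by have := mulr_ge0 v0 v0; lra.
by rewrite mulr_ge0//; lra.
Qed.

Definition threshold_exp (c : R) k := Num.truncn (((c ^+ (2 * k)) * k.+1%:R)^-1).

Lemma cvg_harmonic_mul (B : R) : (fun k : nat => B / k.+1%:R) @ \oo --> (0 : R).
Proof.
rewrite -(mulr0 B); apply: cvgM; first exact: cvg_cst.
exact: cvg_harmonic.
Qed.

(* The exponents [threshold_exp c k] are of order [c ^- (2k) / (k + 1)], so that
   [threshold_exp c k * u ^ (2k)] tends to [0] for [u <= c], including [u = c], and to
   infinity for [u > c]. *)
Lemma threshold_cvg (c u : R) : 0 < c -> 0 <= u -> u <= 1 ->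
  (fun k => (1 - u ^+ (2 * k)) ^+ threshold_exp c k) @ \oo --> ((u <= c)%R%:R : R).
Proof.
move=> c0 u0 u1.
have v0 k : 0 <= u ^+ (2 * k) by rewrite exprn_ge0.
have v1 k : u ^+ (2 * k) <= 1 by rewrite exprn_ile1.
have ck k : 0 < c ^+ (2 * k) * k.+1%:R by rewrite mulr_gt0 ?exprn_gt0.
have up k : (1 - u ^+ (2 * k)) ^+ threshold_exp c k <= 1.
  by rewrite exprn_ile1 ?subr_ge0// gerBl.
have lo k : 0 <= (1 - u ^+ (2 * k)) ^+ threshold_exp c k.
  by rewrite exprn_ge0// subr_ge0.
have [uc|cu] := leP u c.
  have H k : 1 - 1 / k.+1%:R <= (1 - u ^+ (2 * k)) ^+ threshold_exp c k.
    apply: le_trans (bernoulli_ge _ _); last by have := v1 k; lra.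
    rewrite mulrN lerD2l lerN2.
    have : (threshold_exp c k)%:R <= (c ^+ (2 * k) * k.+1%:R)^-1.
      by rewrite truncn_le// invr_ge0 ltW.
    move=> /(ler_wpM2r (v0 k)) /le_trans; apply.
    rewrite invfM mulrAC ler_wpM2r ?invr_ge0// mulrC ler_pdivrMr ?exprn_gt0// mul1r.
    by rewrite lerXn2r// nnegrE// ltW.
  apply: (@squeeze_cvgr _ _ _ _ (fun k => 1 - 1 / k.+1%:R) (fun=> 1)).
  - by apply: nearW => k; rewrite H up.
  - rewrite -[X in _ --> X]subr0; apply: cvgB; first exact: cvg_cst.
    exact: cvg_harmonic_mul.
  - exact: cvg_cst.
pose s := u / c; have s1 : 1 < s by rewrite ltr_pdivlMr// mul1r.
(* As [dl <= 1], Bernoulli gives [s ^ k >= 1 + k * dl >= dl * k.+1], whose square outweighs the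
   [k.+1] in [threshold_exp]. *)
pose dl := Num.min (s - 1) 1.
have dl0 : 0 < dl by rewrite lt_min ltr01 subr_gt0 s1.
have dl1 : dl <= 1 by rewrite ge_min lexx orbT.
have dls : 1 + dl <= s by rewrite addrC -lerBrDr ge_min lexx.
have sk k : (dl * k.+1%:R) ^+ 2 <= s ^+ (2 * k).
  rewrite mulnC exprM lerXn2r ?nnegrE ?mulr_ge0 ?exprn_ge0 ?(ltW dl0) ?(ltW (lt_trans ltr01 s1))//.
  apply: (@le_trans _ _ ((1 + dl) ^+ k)); last first.
    by rewrite lerXn2r ?nnegrE ?addr_ge0 ?(ltW dl0) ?(ltW (lt_trans ltr01 s1)).
  apply: le_trans (bernoulli_ge _ _); last by lra.
  by rewrite -natr1 mulrDr mulr1 addrC lerD// mulrC.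
have Nv k : dl ^+ 2 * k.+1%:R - 1 <= (threshold_exp c k)%:R * u ^+ (2 * k).
  have /ltW : (c ^+ (2 * k) * k.+1%:R)^-1 < (threshold_exp c k).+1%:R by rewrite truncnS_gt.
  rewrite -[(threshold_exp c k).+1%:R]natr1 => /(ler_wpM2r (v0 k)); rewrite mulrDl mul1r => H.
  rewrite lerBlDr; apply: le_trans (le_trans H _); last by rewrite lerD2l.
  have := sk k; rewrite expr_div_n exprMn ler_pdivlMr ?exprn_gt0// => H'.
  rewrite [leRHS]mulrC ler_pdivlMr//; apply: le_trans H'.
  rewrite le_eqVlt; apply/orP; left; apply/eqP; ring.
have H k : (1 - u ^+ (2 * k)) ^+ threshold_exp c k <= dl ^- 2 / k.+1%:R.
  apply: le_trans (exprB_le_inv _ (v0 k) (v1 k)) _.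
  rewrite -invfM lef_pV2 ?posrE ?mulr_gt0 ?exprn_gt0// ?ltr_pwDl ?mulr_ge0//.
  by have := Nv k; lra.
apply: (@squeeze_cvgr _ _ _ _ (fun=> 0) (fun k => dl ^- 2 / k.+1%:R)).
- by apply: nearW => k; rewrite H lo.
- exact: cvg_cst.
- exact: cvg_harmonic_mul.
Qed.

End Thresholds.

Section EvenMoments.
Variables (R : realType) (mu : {measure set (measurableTypeR R) -> \bar R}).
Let D : set (measurableTypeR R) := `]0, 1[%classic.
Variable y : R -> R.
Hypothesis yint : mu.-integrable D (EFin \o y).

Let mD : measurable D.
Proof. exact: measurable_itv. Qed.

Definition even_moment j := Rintegral mu D (fun x => y x * x ^+ (2 * j)).

Lemma integrable_mul_bounded (h : R -> R) (B : R) : measurable_fun D h ->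
  (forall x, D x -> `|h x| <= B) -> mu.-integrable D (EFin \o (fun x => y x * h x)).
Proof.
move=> mh hB; apply: (integrableMl mD yint mh).
exists B; split; first exact: num_real.
by move=> x Bx z Dz /=; rewrite (le_trans (hB z Dz))// ltW.
Qed.

Lemma Rintegral_mul_bound (h : R -> R) (B : R) : measurable_fun D h ->
  (forall x, D x -> `|h x| <= B) ->
  `|Rintegral mu D (fun x => y x * h x)| <= Rintegral mu D (fun x => `|y x|) * B.
Proof.
move=> mh hB; have ih := integrable_mul_bounded mh hB.
rewrite (le_trans (le_normr_Rintegral mD ih))//.
have iy : mu.-integrable D (EFin \o (fun x => `|y x|)).
  by have := integrable_abse yint.
rewrite -RintegralZr//; apply: le_Rintegral => //.
- by have := integrable_abse ih.
- by have := integrableZr mD B iy; apply: eq_integrable => // x _.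
- by move=> x Dx /=; rewrite normrM ler_wpM2l// hB.
Qed.

Lemma measurable_even_power j : measurable_fun D (fun x : R => x ^+ (2 * j)).
Proof. by apply: measurable_funX; exact: measurable_id. Qed.

Lemma even_power_le1 j x : D x -> `|x ^+ (2 * j)| <= 1.
Proof.
rewrite /D /= in_itv /= => /andP[x0 x1].
by rewrite normrX exprn_ile1// gtr0_norm// ltW.
Qed.

Lemma measurable_even_sum (d : nat -> R) N :
  measurable_fun D (fun x : R => \sum_(j < N) d j * x ^+ (2 * j)).
Proof.
apply: measurable_sum => j; apply: measurable_funM; first exact: measurable_cst.
exact: measurable_even_power.
Qed.

Lemma Rintegral_even_sum (d : nat -> R) N :
  Rintegral mu D (fun x => y x * \sum_(j < N) d j * x ^+ (2 * j)) =
  \sum_(j < N) d j * even_moment j.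
Proof.
have ip j : mu.-integrable D (EFin \o (fun x => y x * x ^+ (2 * j))).
  by apply: integrable_mul_bounded; [exact: measurable_even_power|exact: even_power_le1].
elim: N => [|N IH].
  rewrite big_ord0; under eq_Rintegral do rewrite big_ord0 mulr0.
  by rewrite Rintegral_cst// mul0r.
rewrite big_ord_recr -IH /=.
under eq_Rintegral do rewrite big_ord_recr mulrDr mulrCA.
rewrite RintegralD//.
- by rewrite RintegralZl.
- apply: (@integrable_mul_bounded _ (\sum_(j < N) `|d j|)); first exact: measurable_even_sum.
  move=> x Dx; rewrite (le_trans (ler_norm_sum _ _ _))// ler_sum// => j _.
  by rewrite normrM ler_piMr// even_power_le1.
- by have := integrableZl mD (d N) (ip N); apply: eq_integrable => // x _.
Qed.

Lemma even_moment_bound (d : nat -> R) N B :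
  (forall t, 0 <= t -> t <= 1 -> `|\sum_(j < N) d j * t ^+ j| <= B) ->
  `|\sum_(j < N) d j * even_moment j| <= Rintegral mu D (fun x => `|y x|) * B.
Proof.
move=> H; rewrite -Rintegral_even_sum; apply: Rintegral_mul_bound.
  exact: measurable_even_sum.
move=> x; rewrite /D /= in_itv /= => /andP[x0 x1].
under eq_bigr do rewrite exprM.
by apply: H; rewrite ?sqr_ge0// exprn_ile1// ltW.
Qed.

Lemma Rintegral_dominated (h_ : nat -> R -> R) (h : R -> R) (B : R) :
  (forall n, measurable_fun D (h_ n)) -> measurable_fun D h ->
  (forall x, D x -> (h_ ^~ x) @ \oo --> h x) ->
  (forall n x, D x -> `|h_ n x| <= B) ->
  (fun n => Rintegral mu D (fun x => y x * h_ n x)) @ \oo -->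
  Rintegral mu D (fun x => y x * h x).
Proof.
move=> mh_ mh hh hB.
have my : measurable_fun D y by apply/measurable_EFinP; exact: measurable_int yint.
have [|||||] := @dominated_convergence _ _ _ mu D mD
  (fun n x => (y x * h_ n x)%:E) (fun x => (y x * h x)%:E) (fun x => (`|y x| * B)%:E).
- by move=> n; apply/measurable_EFinP; exact: measurable_funM.
- by apply/measurable_EFinP; exact: measurable_funM.
- apply: aeW => x Dx; apply: cvg_EFin; first exact: nearW.
  by apply: cvgM; [exact: cvg_cst|exact: hh].
- have := integrableZr mD B (integrable_abse yint).
  by apply: eq_integrable => // x _.
- by apply: aeW => x n Dx; rewrite /= lee_fin normrM ler_wpM2l// hB.
move=> ih _ cv; rewrite /Rintegral; apply: fine_cvg.
by rewrite fineK//; exact: integrable_fin_num.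
Qed.

Hypothesis mo0 : forall j, even_moment j = 0.

(** The approximants of [threshold_cvg] at [u = x ^ 2] are polynomials in [x ^ 2], annihilated by
    [mo0], and are bounded by 1, so the integrals pass to the limit. *)
Lemma Rintegral_threshold (c : R) : 0 < c ->
  Rintegral mu D (fun x => y x * (x ^+ 2 <= c)%R%:R) = 0.
Proof.
move=> c0; pose h_ k (x : R) := (1 - (x ^+ 2) ^+ (2 * k)) ^+ threshold_exp c k.
have hE k : exists (d : nat -> R) (N : nat), forall x : R, h_ k x = \sum_(j < N) d j * x ^+ (2 * j).
  pose p : {poly R} := (1 - 'X^(2 * k)) ^+ threshold_exp c k.
  exists (nth 0 p), (size p) => x; under eq_bigr do rewrite exprM.
  by rewrite -horner_coef horner_exp hornerD hornerN hornerXn hornerC.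
have mh k : measurable_fun D (h_ k).
  have [d [N dE]] := hE k; rewrite (_ : h_ k = fun x => \sum_(j < N) d j * x ^+ (2 * j)).
    exact: measurable_even_sum.
  exact/funext.
have D2 x : D x -> 0 <= x ^+ 2 /\ x ^+ 2 <= 1.
  rewrite /D /= in_itv /= => /andP[x0 x1]; split; first exact: sqr_ge0.
  by rewrite exprn_ile1// ltW.
have hc x : D x -> (h_ ^~ x) @ \oo --> ((x ^+ 2 <= c)%R%:R : R).
  by move=> /D2[x0 x1]; exact: threshold_cvg.
have h1 k x : D x -> `|h_ k x| <= 1.
  move=> /D2[x0 x1]; have u0 : 0 <= (x ^+ 2) ^+ (2 * k) by rewrite exprn_ge0.
  have u1 : (x ^+ 2) ^+ (2 * k) <= 1 by rewrite exprn_ile1.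
  by rewrite normrX exprn_ile1// ger0_norm ?subr_ge0// gerBl.
have mhc : measurable_fun D (fun x : R => (x ^+ 2 <= c)%R%:R : R).
  exact: measurable_fun_cvg mh hc.
rewrite -(cvg_lim _ (Rintegral_dominated mh mhc hc h1))//.
rewrite (_ : (fun n => _) = fun=> 0) ?lim_cst//; apply/funext => k.
have [d [N dE]] := hE k; under eq_Rintegral do rewrite dE.
by rewrite Rintegral_even_sum big1// => j _; rewrite mo0 mulr0.
Qed.

Let null (S : set (measurableTypeR R)) := Rintegral mu D (fun x => y x * \1_S x) = 0.

Let integrable_indic (S : set (measurableTypeR R)) : measurable S ->
  mu.-integrable D (EFin \o (fun x => y x * \1_S x)).
Proof.
move=> mS; apply: (@integrable_mul_bounded _ 1); first exact: measurable_indic.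
by move=> x _; rewrite indicE; case: (_ \in _); rewrite ?normr1// normr0.
Qed.

Let integral_indic_eq (S : set (measurableTypeR R)) :
  (\int[mu]_(x in D `&` S) (y x)%:E = \int[mu]_(x in D) (y x * \1_S x)%R%:E)%E.
Proof.
rewrite integral_mkcondr; apply: eq_integral => x _; rewrite patchE indicE.
by case: ifP => xS; rewrite ?mulr1 ?mulr0.
Qed.

Let nullP (S : set (measurableTypeR R)) : measurable S ->
  null S <-> (\int[mu]_(x in D `&` S) (y x)%:E = 0)%E.
Proof.
move=> mS; rewrite /null /Rintegral integral_indic_eq; split=> [h|->]//.
by rewrite -[LHS]fineK ?h//; exact: integrable_fin_num (integrable_indic mS).
Qed.

Let null_setT : null setT.
Proof.
rewrite /null; have := mo0 0; rewrite /even_moment; move=> <-.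
by apply: eq_Rintegral => x _; rewrite indicE in_setT expr0.
Qed.

Let null_setC S : measurable S -> null S -> null (~` S).
Proof.
move=> mS S0; rewrite /null -[RHS](subrr 0) -{1}null_setT -S0 -RintegralB//; last 2 first.
- exact: integrable_indic.
- exact: integrable_indic.
apply: eq_Rintegral => x _; rewrite !indicE in_setT in_setC.
by case: (x \in S); rewrite /= ?mulr0 ?mulr1 ?subrr ?subr0.
Qed.

(** Open rays are stable under intersection and generate the Borel sets, and [null] is stable under
    complements and disjoint unions: Dynkin's theorem applies. *)
Let null_measurable S : measurable S -> null S.
Proof.
rewrite [measurable]RGenOInfty.measurableE => mS.
have sS : <<s @RGenOInfty.G R >> S := mS.
apply: (@dynkin_induction _ (measurableTypeR R) (@RGenOInfty.G R) null _ _ _ _ _ _ S sS).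
- exact: RGenOInfty.measurableE.
- move=> _ _ [a ->] [b ->]; exists (Num.max a b); apply/seteqP.
  split=> x /=; rewrite !in_itv /= !andbT gt_max; first by move=> [-> ->].
  by move=> /andP[].
- exact: null_setT.
(* For [s <= 0] the ray contains [D]; otherwise its complement meets [D] exactly where
   [x ^ 2 <= s ^ 2]. *)
- move=> _ [s ->]; have [s0|s0] := leP s 0.
    apply: etrans _ null_setT; apply: eq_Rintegral => x; rewrite inE /D /= in_itv /= => /andP[x0 _].
    rewrite !indicE in_setT; suff -> : x \in `]s, +oo[%classic by [].
    by rewrite inE /= in_itv /= andbT (le_lt_trans s0).
  rewrite -setCitvl; apply: null_setC; first exact: measurable_itv.
  apply: etrans _ (Rintegral_threshold (exprn_gt0 2 s0)); apply: eq_Rintegral => x.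
  rewrite inE /D /= in_itv /= => /andP[x0 _]; rewrite indicE; congr (_ * (nat_of_bool _)%:R).
  rewrite ler_pXn2r ?nnegrE ?(ltW x0) ?(ltW s0)//.
  by apply/idP/idP; rewrite inE /= in_itv.
- by move=> A mA; exact: null_setC.
- move=> F mF tF nF; have mU : measurable (\bigcup_k F k) by exact: bigcupT_measurable.
  apply/nullP => //; rewrite setI_bigcupr integral_bigcup.
  + by rewrite eseries0// => k _ _; apply/nullP.
  + exact: trivIset_setIl.
  + by move=> k; exact: measurableI.
  + apply: integrableS yint => //; first by apply: bigcupT_measurable => k; exact: measurableI.
    by move=> x [k _ []].
Qed.

Lemma even_moments_ae0 : {ae mu, forall x, D x -> y x = 0}.
Proof.
have := @integral_ae_eq _ _ _ mu D mD (cst 0%E) (EFin \o y) yint (measurable_cst _) _.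
case=> [E ED mE|N [mN N0 sub]].
  rewrite integral0; have -> : E = D `&` E by rewrite setIidr.
  by apply/nullP => //; exact: null_measurable.
exists N; split => // x Hx; apply: sub => /= H; apply: Hx => Dx.
by have := H Dx => /= -[].
Qed.

End EvenMoments.

(** * Even alternating series of order less than two *)

Section EvenSeries.
Variable R : realType.
Local Notation C := R[i].
Variables (a : nat -> R) (f : C -> C).
Hypothesis a_ge0 : forall n, 0 <= a n.
Hypothesis f_series : even_alternating_series a f.

Lemma even_series_cvg z e : 0 < e ->
  exists N0, forall N, (N0 <= N)%N -> cabs (f z - psum (alt_coef a) (z ^+ 2) N) < e.
Proof.
move=> e0; have eC : 0 < e%:C :> C by rewrite ltcR.
have [N0 _ H] := proj1 (cvgrPdist_lt _ _) (@f_series z) e%:C eC.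
exists N0 => N /H /=; rewrite cabsE ltcR.
rewrite (_ : series _ N = psum (alt_coef a) (z ^+ 2) N)//.
rewrite /series /= big_mkord; apply: eq_bigr => j _.
by rewrite /alt_coef rmorphM rmorphXn rmorphN1 -exprM.
Qed.

Lemma psum_alt_neg r N : 0 <= r ->
  psum (alt_coef a) (- r%:C) N = (abs_psum (alt_coef a) r N)%:C.
Proof.
move=> r0; rewrite /abs_psum rmorph_sum; apply: eq_bigr => j _ /=.
rewrite cabs_real normrM normrX normrN1 expr1n mul1r (ger0_norm (a_ge0 _)).
have -> : alt_coef a j = (-1) ^+ j * (a j)%:C by rewrite /alt_coef rmorphM rmorphXn rmorphN1.
by rewrite [(- r%:C) ^+ j]exprNn mulrACA -exprMn mulrN1 opprK expr1n mul1r -rmorphXn -rmorphM.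
Qed.

Lemma imag_sqrt_sqr r : 0 <= r -> ((Num.sqrt r)%:C * 'i%C) ^+ 2 = - r%:C :> C.
Proof. by move=> r0; rewrite exprMn sqr_i -rmorphXn sqr_sqrtr// mulrN1. Qed.

Lemma abs_psum_alt_le r N : 0 <= r ->
  abs_psum (alt_coef a) r N <= cabs (f ((Num.sqrt r)%:C * 'i%C)).
Proof.
move=> r0; apply/ler_addgt0Pr => e e0.
have [N0 H] := even_series_cvg ((Num.sqrt r)%:C * 'i%C) e0.
rewrite (le_trans (abs_psum_leN _ r0 (leq_maxr N0 N)))//.
have := H _ (leq_maxl N0 N); rewrite imag_sqrt_sqr// psum_alt_neg// cabsC => /ltW h.
have := le_trans (cabs_sub_ge _ _) h; rewrite cabs_real ger0_norm ?abs_psum_ge0//.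
by rewrite lerBlDl.
Qed.

Lemma entire_alt : entire_coef (alt_coef a).
Proof.
by move=> r r0; exists (cabs (f ((Num.sqrt r)%:C * 'i%C))) => N; exact: abs_psum_alt_le.
Qed.

Lemma even_seriesE z : f z = psum_lim (alt_coef a) (z ^+ 2).
Proof.
by apply/esym/psum_lim_unique; [exact: entire_alt|exact: even_series_cvg].
Qed.

Lemma majorant_le_max_modulus r : 0 <= r ->
  majorant (alt_coef a) r <= max_modulus f (Num.sqrt r).
Proof.
move=> r0; have ea := entire_alt.
apply: (@le_trans _ _ (cabs (f ((Num.sqrt r)%:C * 'i%C)))).
  by apply: majorant_le => N; exact: abs_psum_alt_le.
apply: ub_le_sup; last first.
  exists ((Num.sqrt r)%:C * 'i%C) => //=.
  by rewrite cabsE cabsM cabs_i cabs_real mulr1 ger0_norm.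
exists (majorant (alt_coef a) r) => _ [z /= zr <-]; rewrite -/(cabs _) even_seriesE.
apply: psum_lim_le => //; rewrite cabsX.
by move: zr; rewrite cabsE => /complexI ->; rewrite sqr_sqrtr.
Qed.

(** The way simplicity is used: a quadratic bound near a zero contradicts [real_simple_zeros]. *)
Lemma derive1_quadratic_eq0 z (L : R) : f z = 0 ->
  (forall h, cabs h <= 1 -> cabs (f (h + z)) <= L * cabs h ^+ 2) -> derive1 f z = 0.
Proof.
move=> fz H; rewrite /derive1; apply: cvg_lim; first exact: norm_hausdorff.
have L0 : 0 <= L.
  by have := H 1; rewrite cabs1 expr1n mulr1 => /(_ (lexx _)); apply: le_trans; exact: cabs_ge0.
apply/cvgrPdist_lt => e e0.
have eE : e = (complex.Re e)%:C by rewrite RRe_real// gtr0_real.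
have e0' : 0 < complex.Re e by rewrite -ltcR -eE.
pose dl := Num.min 1 (complex.Re e / (L + 1)).
have dl0 : 0 < dl by rewrite lt_min ltr01 divr_gt0// ltr_wpDl.
have dlC : 0 < dl%:C :> C by rewrite ltcR.
exists dl%:C => //= h; rewrite /ball_ /= sub0r normrN => hd h0.
have hd' : cabs h < dl by rewrite -ltcR -cabsE.
have hp : 0 < cabs h by rewrite cabs_gt0.
rewrite sub0r normrN fz subr0 eE cabsE ltcR /GRing.scale /= cabsM cabsV mulrC.
rewrite ltr_pdivrMr// (le_lt_trans (H h _))//.
  by rewrite (le_trans (ltW hd'))// ge_min lexx.
rewrite expr2 mulrA ltr_pM2r//.
have : cabs h < complex.Re e / (L + 1) by rewrite (lt_le_trans hd')// ge_min lexx orbT.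
rewrite ltr_pdivlMr ?ltr_wpDl// => /(le_lt_trans _); apply.
by rewrite mulrC ler_wpM2l ?cabs_ge0// lerDl.
Qed.

Hypothesis f_zeros : real_simple_zeros f.

(** Otherwise the even function [f] would be [O(z ^ 2)] at 0, a double zero. *)
Lemma alt_coef0_neq0 : a 0%N != 0.
Proof.
apply/eqP => a0; have ea := entire_alt.
have bnd h : cabs h <= 1 -> cabs (f (h + 0)) <= majorant (alt_coef a) 1 * cabs h ^+ 2.
  move=> h1; rewrite addr0 even_seriesE; apply/ler_addgt0Pr => e e0.
  have [N0 HN] := psum_limP (h ^+ 2) ea e0; have := HN N0.+1 (leqnSn _) => /ltW HN1.
  rewrite -[psum_lim _ _](subrK (psum (alt_coef a) (h ^+ 2) N0.+1)) addrC.
  rewrite (le_trans (cabsD _ _))// lerD//.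
  rewrite (le_trans (psum_le _ _ _))// cabsX.
  rewrite (@le_trans _ _ (abs_psum (alt_coef a) 1 N0.+1 * cabs h ^+ 2))//; last first.
    by rewrite ler_wpM2r ?exprn_ge0 ?cabs_ge0// abs_psum_le_majorant.
  rewrite /abs_psum mulr_suml ler_sum// => -[[|j] jN] _ /=.
    by rewrite /alt_coef a0 mulr0 cabs0 !mul0r.
  rewrite expr1n mulr1 ler_wpM2l ?cabs_ge0// exprS ler_piMr ?exprn_ge0 ?cabs_ge0//.
  by rewrite exprn_ile1 ?exprn_ge0 ?cabs_ge0// exprn_ile1 ?cabs_ge0.
have f0 : f 0 = 0.
  apply: cabs_small => e e0.
  by have := bnd 0; rewrite cabs0 addr0 expr0n mulr0 => /(_ ler01) /le_lt_trans; apply.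
have [_] := f_zeros f0; rewrite (derive1_quadratic_eq0 f0 bnd).
by rewrite eqxx.
Qed.

Variable zeta : nat -> R.
Hypothesis zetaP : positive_zeros f zeta.

Lemma zeta_zero k : 0 < zeta k /\ f (zeta k)%:C = 0.
Proof.
have [_ Hr] := zetaP; have : range zeta (zeta k) by exists k.
by rewrite Hr.
Qed.

Lemma alt_coef_simple k d : entire_coef d ->
  alt_coef a <> mulroot ((zeta k) ^+ 2)%:C (mulroot ((zeta k) ^+ 2)%:C d).
Proof.
move=> ed aE; have [z0 fz] := zeta_zero k; set z := zeta k in aE z0 fz.
have zC : z%:C != 0 :> C by rewrite fmorph_eq0 gt_eqF.
have z2 : (z ^+ 2)%:C != 0 :> C by rewrite rmorphXn expf_neq0.
have fE w : f w = (1 - w ^+ 2 / (z ^+ 2)%:C) ^+ 2 * psum_lim d (w ^+ 2).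
  rewrite even_seriesE aE psum_lim_mulroot//; last exact: entire_mulroot.
  by rewrite psum_lim_mulroot// mulrA -expr2.
(* From [1 - (h + z) ^ 2 / z ^ 2 = - h * (2 * z + h) / z ^ 2] with [cabs h <= 1]. *)
pose L := ((2 * z + 1) / z ^+ 2) ^+ 2 * majorant d ((z + 1) ^+ 2).
have [_] := f_zeros fz; rewrite (@derive1_quadratic_eq0 _ L)// ?eqxx// => h h1.
rewrite fE (_ : 1 - _ = - (h * ((2 * z)%:C + h) / (z ^+ 2)%:C)); last first.
  rewrite rmorphXn [(2 * z)%:C]rmorphM rmorph_nat /=; field.
  by rewrite zC.
rewrite sqrrN cabsM cabsX !cabsM cabsV cabs_real (ger0_norm (sqr_ge0 _)).
have s1 : cabs ((2 * z)%:C + h) <= 2 * z + 1.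
  by rewrite (le_trans (cabsD _ _))// lerD// cabs_real ger0_norm// mulr_ge0// ltW.
have s2 : cabs (psum_lim d ((h + z%:C) ^+ 2)) <= majorant d ((z + 1) ^+ 2).
  apply: psum_lim_le => //; rewrite cabsX lerXn2r ?nnegrE ?cabs_ge0 ?addr_ge0 ?(ltW z0)//.
  by rewrite (le_trans (cabsD _ _))// addrC lerD// cabs_real gtr0_norm.
rewrite /L [leRHS]mulrAC ler_pM ?cabs_ge0 ?exprn_ge0 ?divr_ge0 ?mulr_ge0 ?cabs_ge0 ?invr_ge0 ?sqr_ge0 ?(ltW z0)//.
rewrite -mulrA exprMn mulrC ler_wpM2r ?exprn_ge0 ?cabs_ge0//.
rewrite lerXn2r ?nnegrE ?mulr_ge0 ?invr_ge0 ?sqr_ge0 ?cabs_ge0 ?addr_ge0 ?mulr_ge0 ?(ltW z0)//.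
by rewrite ler_wpM2r ?invr_ge0 ?sqr_ge0.
Qed.

(** A square root of [w] is a zero of [f], hence real, and nonzero by [alt_coef0_neq0]; by evenness
    its absolute value is a positive zero. *)
Lemma alt_coef_zeros w : psum_lim (alt_coef a) w = 0 -> exists k, w = ((zeta k) ^+ 2)%:C.
Proof.
move=> w0; have fw : f (sqrtc w) = 0 by rewrite even_seriesE sqr_sqrtc.
have [im0 _] := f_zeros fw.
have [x sE] : exists x : R, sqrtc w = x%:C.
  by exists (complex.Re (sqrtc w)); rewrite [LHS]complexE im0 mulr0 addr0.
have wE : w = (x ^+ 2)%:C by rewrite rmorphXn /= -sE sqr_sqrtc.
have x0 : x != 0.
  apply/eqP => x0; move: alt_coef0_neq0; have := w0; rewrite wE x0 expr0n /=.
  have -> : psum_lim (alt_coef a) 0 = alt_coef a 0.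
    apply: psum_lim_unique; first exact: entire_alt.
    move=> e e0; exists 1%N => -[//|N] _.
    rewrite /psum big_ord_recl expr0 mulr1 big1 ?addr0 ?subrr ?cabs0// => j _.
    by rewrite expr0n mulr0.
  by rewrite /alt_coef expr0 mul1r => /complexI ->; rewrite eqxx.
have [_ Hr] := zetaP.
have : range zeta `|x|.
  rewrite Hr; split; first by rewrite /= normr_gt0.
  have xw : `|x|%:C ^+ 2 = w by rewrite wE -(real_normK (num_real x)) rmorphXn.
  by rewrite /zero_set /= even_seriesE xw.
by move=> [k _ kx]; exists k; rewrite kx real_normK ?num_real.
Qed.

Hypothesis f_order : (growth_order f < 2%:E)%E.

Lemma growth_dyadic : exists A q, [/\ 0 <= A, 1 <= q, q < 2 &
  forall i, majorant (alt_coef a) (2 ^+ i) <= cabs (alt_coef a 0%N) * expR (A * q ^+ i)].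
Proof.
have ea := entire_alt.
have c0 : 0 < cabs (alt_coef a 0%N).
  by rewrite cabs_gt0 /alt_coef expr0 mul1r fmorph_eq0 alt_coef0_neq0.
have [rho [r0 [rho0 rho2 Hr]]] : exists rho r0 : R, [/\ 0 <= rho, rho < 2 &
    forall r, r0 < r -> ln (ln (max_modulus f r)) / ln r <= rho].
  have [_ [V [r0 [_ HV]] <-] Hs] := ereal_inf_lt f_order.
  set s := ereal_sup _ in Hs.
  have us r : r0 < r -> ((ln (ln (max_modulus f r)) / ln r)%:E <= s)%E.
    by move=> rr; apply: ereal_sup_ubound; exists r => //; exact: HV.
  (* The maximum makes the exponent nonnegative and also covers [s = -oo], where [fine] returns
     0. *)
  exists (Num.max 0 (fine s)), r0; split.
  - by rewrite le_max lexx.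
  - rewrite gt_max ltr0n /=; case: s Hs {us} => [s||] //=; by rewrite ?lte_fin// ltr0n.
  - move=> r rr; have := us r rr; case: s Hs {us} => [s||] //= _.
    by rewrite lee_fin => h; rewrite le_max h orbT.
(* [q = 2 ^ (rho / 2)], so that [r ^ rho = q ^ i] at [r = sqrt (2 ^ i)]. *)
pose q := expR (rho * ln 2 / 2).
have l2 : 0 < ln 2 :> R by rewrite ln_gt0// ltr1n.
have q1 : 1 <= q by rewrite -expR0 ler_expR divr_ge0// mulr_ge0// ltW.
have q2 : q < 2.
  rewrite -[ltRHS]lnK ?posrE// ltr_expR mulrAC -[ltRHS]mul1r ltr_pM2r//.
  by rewrite ltr_pdivrMr// mul1r.
have [i0 Hi0] := exists_expr_gt (Num.max 1 r0 ^+ 2).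
have big i : (i0 <= i)%N -> majorant (alt_coef a) (2 ^+ i) <= expR (q ^+ i).
  move=> ii; have p0 : 0 <= 2 ^+ i :> R by rewrite exprn_ge0.
  apply: (le_trans (majorant_le_max_modulus p0)); set r := Num.sqrt _.
  have rbig : Num.max 1 r0 < r.
    rewrite -(ltr_pXn2r (n := 2))// ?nnegrE ?sqrtr_ge0 ?le_max ?ler01//.
    by rewrite sqr_sqrtr// (lt_le_trans Hi0)// ler_weXn2l// ler1n.
  have r1 : 1 < r by rewrite (le_lt_trans _ rbig)// le_max lexx.
  have := Hr r; rewrite (le_lt_trans _ rbig) ?le_max ?lexx ?orbT// => /(_ isT).
  have lr : 0 < ln r by rewrite ln_gt0.
  rewrite ler_pdivrMr// => H.
  have lrE : rho * ln r = ln (q ^+ i).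
    rewrite lnXn ?expR_gt0// expRK.
    have r2 : r ^+ 2 = 2 ^+ i by exact: sqr_sqrtr.
    have : ln (r ^+ 2) = ln (2 ^+ i) by rewrite r2.
    have rp : 0 < r := lt_trans ltr01 r1.
    rewrite !lnXn// => h.
    have {}h : 2 * ln r = i%:R * ln 2 by rewrite !mulr_natl.
    have -> : ln r = i%:R * ln 2 / 2 by rewrite -h mulrC mulKf// pnatr_eq0.
    by rewrite -[RHS]mulr_natl; field.
  rewrite lrE in H; set M := max_modulus f r in H *.
  (* For [M <= 1] the iterated logarithm only has its default value, and the bound is immediate. *)
  have [M1|M1] := leP M 1.
    by rewrite (le_trans M1)// -expR0 ler_expR exprn_ge0// (le_trans ler01).
  have lM : 0 < ln M by rewrite ln_gt0.
  rewrite ler_ln ?posrE ?exprn_gt0 ?(lt_le_trans ltr01 q1)// in H.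
  by rewrite -[M]lnK ?posrE ?(lt_trans ltr01 M1)// ler_expR.
(* The first summand shifts the bound from [i >= i0] to all [i]; the second absorbs the factor
   [cabs (alt_coef a 0)]. *)
pose A := q ^+ i0 + `|ln (cabs (alt_coef a 0%N))|.
have q0 : 0 < q by rewrite (lt_le_trans ltr01).
exists A, q; split => //; first by rewrite addr_ge0// exprn_ge0// ltW.
move=> i; apply: (@le_trans _ _ (majorant (alt_coef a) (2 ^+ (i0 + i)))).
  by apply: majorant_ler => //; rewrite ?exprn_ge0// ler_weXn2l ?ler1n// leq_addl.
rewrite (le_trans (big _ (leq_addr _ _)))// -[X in _ <= X * _]lnK ?posrE// -expRD ler_expR.
rewrite /A mulrDl exprD; set l := ln _.
have h : - l <= `|l| * q ^+ i.
  rewrite (@le_trans _ _ `|l|)//; first by rewrite -normrN ler_norm.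
  by rewrite ler_peMr// exprn_ege1.
lra.
Qed.

(** The constants may be enlarged so that [f] and [g] can share them. *)
Lemma small_order_zeros_even : exists A q, [/\ 0 <= A, 1 <= q, q < 2 &
  forall A' q', A <= A' -> q <= q' ->
  small_order_zeros (alt_coef a) (fun k => zeta k ^+ 2) A' q'].
Proof.
have [A [q [A0 q1 q2 H]]] := growth_dyadic; exists A, q; split => // A' q' AA qq.
have q0 : 0 <= q by rewrite (le_trans ler01).
split.
- by move=> k; have [z0 _] := zeta_zero k; rewrite exprn_gt0.
- move=> m n mn; have [z0 _] := zeta_zero m; have [z1 _] := zeta_zero n.
  by rewrite ltr_pXn2r ?nnegrE ?ltW//; have [h _] := zetaP; exact: h.
- exact: entire_alt.
- by rewrite /alt_coef expr0 mul1r fmorph_eq0 alt_coef0_neq0.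
- move=> i; rewrite (le_trans (H i))// ler_wpM2l ?cabs_ge0// ler_expR.
  by rewrite ler_pM ?exprn_ge0// lerXn2r ?nnegrE ?(le_trans q0 qq).
- by move=> k; have [_ fz] := zeta_zero k; rewrite rmorphXn -even_seriesE.
- exact: alt_coef_zeros.
- exact: alt_coef_simple.
Qed.

End EvenSeries.

Lemma even_series_real (R : realType) (a : nat -> R) (f : R[i] -> R[i]) :
  even_alternating_series a f ->
  forall x : R, f x%:C = (complex.Re (f x%:C))%:C /\
    (fun N => \sum_(j < N) (-1) ^+ j * a j * x ^+ (2 * j)) @ \oo --> complex.Re (f x%:C).
Proof.
move=> fs x.
have E N : psum (alt_coef a) (x%:C ^+ 2) N = (\sum_(j < N) (-1) ^+ j * a j * x ^+ (2 * j))%:C.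
  rewrite /psum rmorph_sum; apply: eq_bigr => j _ /=.
  by rewrite -rmorphXn -rmorphXn -exprM -rmorphM.
have im0 : complex.Im (f x%:C) = 0.
  apply/eqP; rewrite -normr_eq0 eq_le normr_ge0 andbT; apply/ler_addgt0Pr => e e0.
  have [N0 H] := even_series_cvg fs x%:C e0.
  have := H N0 (leqnn _); rewrite E => /ltW h.
  rewrite add0r (le_trans _ h)//; apply: le_trans (Im_le_cabs _).
  by rewrite raddfB /= subr0.
split; first by rewrite [LHS]complexE im0 mulr0 addr0.
apply/cvgrPdist_lt => e e0; have [N0 H] := even_series_cvg fs x%:C e0.
exists N0 => // N /H; rewrite E; apply: le_lt_trans; apply: le_trans (Re_le_cabs _).
by rewrite raddfB.
Qed.

Section RealCompleteness.
Variables (R : realType) (mu : {measure set (measurableTypeR R) -> \bar R}).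
Let D : set (measurableTypeR R) := `]0, 1[%classic.
Variables (a b : nat -> R) (f g : R[i] -> R[i]) (zeta lambda : nat -> R).
Hypothesis a_ge0 : forall n, 0 <= a n.
Hypothesis b_ge0 : forall n, 0 <= b n.
Hypothesis f_series : even_alternating_series a f.
Hypothesis g_series : even_alternating_series b g.
Hypothesis f_zeros : real_simple_zeros f.
Hypothesis g_zeros : real_simple_zeros g.
Hypothesis zetaP : positive_zeros f zeta.
Hypothesis lambdaP : positive_zeros g lambda.
Hypothesis f_order : (growth_order f < 2%:E)%E.
Hypothesis g_order : (growth_order g < 2%:E)%E.
Hypothesis ab_cvg0 : (fun n => a n / b n) @ \oo --> (0 : R).
Hypothesis lambda_le_zeta : forall n, lambda n <= zeta n.

Lemma real_complete (y : R -> R) : mu.-integrable D (EFin \o y) ->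
  (forall n, Rintegral mu D (fun x => y x * complex.Re (f (lambda n * x)%:C)) = 0) ->
  {ae mu, forall x, D x -> y x = 0}.
Proof.
move=> yint H; apply: even_moments_ae0 => //.
have [A1 [q1 [A10 q11 q12 H1]]] := small_order_zeros_even a_ge0 f_series f_zeros zetaP f_order.
have [A2 [q2 [A20 q21 q22 H2]]] := small_order_zeros_even b_ge0 g_series g_zeros lambdaP g_order.
have ea := entire_alt a_ge0 f_series.
have coef0 (u : nat -> R) h : (forall n, 0 <= u n) -> even_alternating_series u h ->
    real_simple_zeros h -> 0 < u 0%N.
  by move=> u0 us hz; rewrite lt_def (alt_coef0_neq0 u0 us hz) u0.
have Y0 : 0 <= Rintegral mu D (fun x => `|y x|) by apply: Rintegral_ge0.
apply: (@moments_eq0 R (even_moment mu y) (Rintegral mu D (fun x => `|y x|)) Y0 _ a b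
  (fun k => zeta k ^+ 2) (fun k => lambda k ^+ 2) (Num.max A1 A2) (Num.max q1 q2)).
- by move=> d N B; exact: even_moment_bound.
- by rewrite le_max A10.
- by rewrite le_max q11.
- by rewrite gt_max q12.
- exact: coef0 f_series f_zeros.
- exact: coef0 g_series g_zeros.
- by apply: H1; rewrite le_max lexx.
- by apply: H2; rewrite le_max lexx orbT.
- move=> k; have [z0 _] := zeta_zero zetaP k; have [l0 _] := zeta_zero lambdaP k.
  by rewrite lerXn2r ?nnegrE ?(ltW z0) ?(ltW l0).
- exact: ab_cvg0.
- move=> k.
  (* Termwise integration turns [H] into the vanishing of the moment series at [lambda k ^ 2]; the
     partial sums are dominated on [D] by the majorant there. *)
  pose d j := (-1) ^+ j * a j * lambda k ^+ (2 * j).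
  pose h_ N (x : R) := \sum_(j < N) d j * x ^+ (2 * j).
  pose h (x : R) := complex.Re (f (lambda k * x)%:C).
  have hh x : h_ ^~ x @ \oo --> h x.
    have [_] := even_series_real f_series (lambda k * x).
    rewrite (_ : (fun N => _) = h_ ^~ x)//; apply/funext => N; apply: eq_bigr => j _.
    by rewrite /d exprMn mulrA.
  have mh N : measurable_fun D (h_ N).
    exact: (measurable_even_sum d N).
  have mhl : measurable_fun D h by exact: (measurable_fun_cvg mh (fun x _ => hh x)).
  have hB N x : D x -> `|h_ N x| <= majorant (alt_coef a) (lambda k ^+ 2).
    move=> Dx; rewrite (le_trans (ler_norm_sum _ _ _))//.
    rewrite (le_trans _ (abs_psum_le_majorant N ea (sqr_ge0 _)))// ler_sum// => j _.
    rewrite normrM (le_trans (ler_wpM2l (normr_ge0 _) (even_power_le1 j Dx)))// mulr1.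
    by rewrite /d normrM /alt_coef cabs_real exprM [`|_ ^+ j|]ger0_norm// exprn_ge0// sqr_ge0.
  have := Rintegral_dominated yint mh mhl (fun x _ => hh x) hB.
  rewrite H => cv.
  have em := entire_moment (even_moment_bound yint) ea.
  apply: psum_lim_unique => // e e0.
  have [N0 _ HN] := proj1 (cvgrPdist_lt _ _) cv e e0.
  exists N0 => N /HN /=; rewrite (Rintegral_even_sum yint d N) sub0r normrN => hN.
  rewrite sub0r cabsN (_ : psum _ _ N = (\sum_(j < N) d j * even_moment mu y j)%:C).
    by rewrite cabs_real.
  rewrite /psum rmorph_sum; apply: eq_bigr => j _.
  rewrite /moment_coef /alt_coef -rmorphXn -!rmorphM /= -exprM; congr (_%:C).
  by rewrite /d mulrAC.
Qed.

End RealCompleteness.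

Theorem theorem2 (R : realType)
  (mu : {measure set (measurableTypeR R) -> \bar R})
  (a b : nat -> R) (f g : R[i] -> R[i]) (zeta lambda : nat -> R)
  (a_ge0 : forall n, 0 <= a n) (b_ge0 : forall n, 0 <= b n)
  (f_series : even_alternating_series a f)
  (g_series : even_alternating_series b g)
  (f_entire : entire f) (g_entire : entire g)
  (f_zeros : real_simple_zeros f) (g_zeros : real_simple_zeros g)
  (f_zeros_infinite : (zero_set f #= [set: nat])%card)
  (g_zeros_infinite : (zero_set g #= [set: nat])%card)
  (zetaP : positive_zeros f zeta) (lambdaP : positive_zeros g lambda)
  (f_order : (growth_order f < 2%:E)%E) (g_order : (growth_order g < 2%:E)%E)
  (ab_cvg0 : (fun n => a n / b n) @ \oo --> (0 : R))
  (lambda_le_zeta : forall n, lambda n <= zeta n) :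
  complete_L1 mu `]0, 1[ (fun n x => f (lambda n * x)%:C).
Proof.
move=> y [yRe yIm] H.
have fE x : f x%:C = (complex.Re (f x%:C))%:C.
  by have [] := even_series_real f_series x.
(* [f] is real on the real axis, so the condition on [y] splits into its real and imaginary
   parts. *)
have split_int n : Rintegral mu `]0, 1[
      (fun x => complex.Re (y x) * complex.Re (f (lambda n * x)%:C)) = 0 /\
    Rintegral mu `]0, 1[
      (fun x => complex.Im (y x) * complex.Re (f (lambda n * x)%:C)) = 0.
  have := H n; rewrite /Cintegral => -[hR hI]; split.
    rewrite -[RHS]hR; apply: eq_Rintegral => x _; rewrite fE.
    by case: (y x) => u v /=; rewrite mulr0 subr0.
  rewrite -[RHS]hI; apply: eq_Rintegral => x _; rewrite fE.
  by case: (y x) => u v /=; rewrite mulr0 add0r.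
have compl := real_complete a_ge0 b_ge0 f_series g_series f_zeros g_zeros
  zetaP lambdaP f_order g_order ab_cvg0 lambda_le_zeta.
have := compl mu _ yRe (fun n => (split_int n).1).
have := compl mu _ yIm (fun n => (split_int n).2).
apply: filterS2 => x hI hR Dx; have := hR Dx; have := hI Dx.
by case: (y x) => u v /= -> ->.
Qed.
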